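(* Let $\Gamma(z)=Cz$ ($z\in\mathbb{C}^n$) for $C\in\mathcal{M}(n)$ with $\|C\|\le 1$ and let $U$ be a holomorphic function on $\mathbb{C}^n$ such that $C_{U,\Gamma}$ is bounded on $F_\psi^2$. Then the weighted composition operator $C_{U,\Gamma}$ is self-adjoint if and only if $$U(z)=\overline{U(0)}\quad\text{for all } z\in\mathbb{C}^n$$ and exactly one of the following holds: (i) $U(0)=0$, in which case $U\equiv 0$ and consequently $C_{U,\Gamma}\equiv 0$; (ii) $U(0)\ne 0$ and $C$ is self-adjoint.
   Context: Let $n\ge 1$. On $\mathbb{C}^n$ write $\langle w,z\rangle=\sum_{j=1}^n w_j\overline{z_j}$ and $|w|^2=\langle w,w\rangle$. $\mathcal{M}(n)$ is the set of complex $n\times n$ matrices, $\|C\|$ is the operator norm of $C$ induced by $|\cdot|$, and a matrix $C$ is self-adjoint if it equals its conjugate transpose $C^*$. Weight: $\psi:[0,\infty)\to[0,\infty)$ is a $C^3$ function with $\psi'(y)>0$, $\psi''(y)\ge 0$, $\psi'''(y)\ge 0$ for all $y\ge 0$. Moreover there is a real number $l<\tfrac12$ such that, with $\phi(y)=y\psi'(y)$, $\phi''(y)=O\big(y^{-1/2}[\phi'(y)]^{1+l}\big)$ as $y\to\infty$; when $n>1$ it is also assumed that $\psi''(y)=O\big(y^{-1/2}[\psi'(y)]^{1+l}\big)$ as $y\to\infty$. Space: $F_\psi^2$ is the Hilbert space of holomorphic functions $g:\mathbb{C}^n\to\mathbb{C}$ with $\int_{\mathbb{C}^n}|g(z)|^2e^{-\psi(|z|^2)}\,d\mu(z)<\infty$,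 with inner product $\langle g,h\rangle_\psi=\int_{\mathbb{C}^n} g(z)\overline{h(z)}e^{-\psi(|z|^2)}\,d\mu(z)$, where $\mu$ is Lebesgue measure on $\mathbb{C}^n$. For holomorphic $U:\mathbb{C}^n\to\mathbb{C}$ and $\Gamma:\mathbb{C}^n\to\mathbb{C}^n$, the weighted composition operator is $C_{U,\Gamma}f=U\cdot(f\circ\Gamma)$. ''Bounded on $F_\psi^2$'' means that the operator maps $F_\psi^2$ into itself and is a bounded linear operator. *)

(* Defs.v *)
From HB Require Import structures.
From mathcomp Require Import all_boot all_order all_algebra.
From mathcomp Require Import spectral sesquilinear complex.
From mathcomp Require Import all_classical all_reals all_analysis.

Set Implicit Arguments.
Unset Strict Implicit.
Unset Printing Implicit Defensive.

Import Order.TTheory GRing.Theory Num.Theory.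
Import numFieldNormedType.Exports.

Local Open Scope classical_set_scope.
Local Open Scope complex_scope.
Local Open Scope sesquilinear_scope.
Local Open Scope ring_scope.

Section ComplexSpace.
Variables (R : realType) (n : nat).

Definition dotC (w z : 'cV[R[i]]_n) : R[i] := \sum_(j < n) w j 0 * (z j 0)^*.

(* [dotC w w] is a nonnegative real, so taking its real part loses nothing. *)
Definition sqnormC (w : 'cV[R[i]]_n) : R := complex.Re (dotC w w).

Definition normC (w : 'cV[R[i]]_n) : R := Num.sqrt (sqnormC w).

Definition opnorm (C : 'M[R[i]]_n) : R :=
  sup [set normC (C *m z) | z in [set z | normC z <= 1]].

Definition selfadjoint_mx (C : 'M[R[i]]_n) : Prop := C = C ^t*.

(* The scalars are R[i], so this is complex Frechet differentiability. The
   topology of 'cV[R[i]]_n is that of the max norm. *)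
Definition holomorphic (f : 'cV[R[i]]_n -> R[i]) : Prop :=
  forall z, differentiable (f : 'cV[R[i]]_n -> R[i]^o) z.

End ComplexSpace.

(* Lebesgue measure on C^n, as a product of 2n copies of the Lebesgue measure
   on R; [vecC] turns a point of the product, read as the list of the real and
   imaginary parts of the coordinates, into the corresponding vector. *)
Record mspace (R : realType) := MSpace {
  ms_display : measure_display;
  ms_carrier : measurableType ms_display;
  ms_measure : {measure set ms_carrier -> \bar R} }.

Fixpoint Cn_space (R : realType) (n : nat) : mspace R :=
  if n is m.+1 then
    @MSpace R _
      (ms_carrier (Cn_space R m) * measurableTypeR R * measurableTypeR R)%type
      (ms_measure (Cn_space R m) \x @lebesgue_measure R \x @lebesgue_measure R)%E
  else @MSpace R _ unit (dirac tt).

Fixpoint vecC (R : realType) (n : nat) :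
    ms_carrier (Cn_space R n) -> 'cV[R[i]]_n :=
  if n is m.+1 then
    fun x => col_mx (x.1.2 +i* x.2)%:M (vecC x.1.1)
  else fun=> 0.

Section Integral.
Variables (R : realType) (n : nat).

Definition eintC (f : 'cV[R[i]]_n -> \bar R) : \bar R :=
  \int[ms_measure (Cn_space R n)]_x f (vecC x).

Definition intC (f : 'cV[R[i]]_n -> R[i]) : R[i] :=
  fine (eintC (fun z => (complex.Re (f z))%:E))
    +i* fine (eintC (fun z => (complex.Im (f z))%:E)).

End Integral.

(* Derivative relative to the half-line [0, +oo[: two-sided at x > 0 and
   one-sided at 0. Only the values of f on [0, +oo[ matter when x >= 0. *)
Section HalfLine.
Variable R : realType.
Implicit Types f g : R -> R.

Definition hquotient f (x : R) : R -> R := fun h => h^-1 * (f (x + h) - f x).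

Definition hfilter (x : R) : set_system R := within [set h | 0 <= x + h] 0^'.

Definition hderivable f (x : R) : Prop :=
  cvg (hquotient f x h @[h --> hfilter x]).

Definition hderive f (x : R) : R :=
  lim (hquotient f x h @[h --> hfilter x]).

Definition C3_halfline f : Prop :=
  (forall k, (k < 3)%N -> forall x, 0 <= x -> hderivable (iter k hderive f) x)
  /\ {within `[0, +oo[, continuous (iter 3 hderive f)}.

Definition bigO_pinfty f g : Prop :=
  exists2 k : R, 0 < k & \forall y \near +oo, `|f y| <= k * `|g y|.

Definition is_weight (n : nat) (psi : R -> R) : Prop :=
  let phi := fun y => y * hderive psi y in
  [/\ forall y, 0 <= y -> 0 <= psi y,
      C3_halfline psi,
      forall y, 0 <= y ->
        [/\ 0 < hderive psi y,
            0 <= iter 2 hderive psi y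
          & 0 <= iter 3 hderive psi y]
    & exists2 l : R, l < 1 / 2 &
        bigO_pinfty (iter 2 hderive phi)
          (fun y => y `^ (- (1 / 2)) * (hderive phi y) `^ (1 + l))
        /\ ((1 < n)%N ->
            bigO_pinfty (iter 2 hderive psi)
              (fun y => y `^ (- (1 / 2)) * (hderive psi y) `^ (1 + l)))].

End HalfLine.

Section FockSpace.
Variables (R : realType) (n : nat) (psi : R -> R).
Implicit Types (f g h : 'cV[R[i]]_n -> R[i]).
Implicit Types (T S : ('cV[R[i]]_n -> R[i]) -> 'cV[R[i]]_n -> R[i]).

Definition density (z : 'cV[R[i]]_n) : R := expR (- psi (sqnormC z)).

Definition in_fock g : Prop :=
  holomorphic g /\
  (eintC (fun z => (complex.Re `|g z| ^+ 2 * density z)%:E) < +oo)%E.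

Definition fock_dot g h : R[i] :=
  intC (fun z => g z * (h z)^* * (density z)%:C).

Definition fock_norm g : R := Num.sqrt (complex.Re (fock_dot g g)).

Definition bounded_on_fock T : Prop :=
  [/\ forall f, in_fock f -> in_fock (T f),
      forall (a : R[i]) f g, in_fock f -> in_fock g ->
        T (fun z => a * f z + g z) = (fun z => a * T f z + T g z)
    & exists M : R, forall f, in_fock f -> fock_norm (T f) <= M * fock_norm f].

Definition is_adjoint T S : Prop :=
  bounded_on_fock S /\
  forall f g, in_fock f -> in_fock g -> fock_dot (T f) g = fock_dot f (S g).

Definition selfadjoint_on_fock T : Prop := is_adjoint T T.

End FockSpace.

Definition wcomp (R : realType) (n : nat) (U : 'cV[R[i]]_n -> R[i])
    (Gamma : 'cV[R[i]]_n -> 'cV[R[i]]_n) (f : 'cV[R[i]]_n -> R[i]) :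
    'cV[R[i]]_n -> R[i] :=
  fun z => U z * f (Gamma z).

Definition exactly_one (P Q : Prop) : Prop := (P \/ Q) /\ ~ (P /\ Q).

(* Main.v *)
(** The key point is that a self-adjoint contraction C acts symmetrically:
    <f o C, g> = <f, g o C>. Diagonalize C = P^* diag(d) P with -1 <= d_j <= 1
    and replace each d_j by the Moebius map w |-> (w + d_j) / (1 + d_j w). This
    gives W(w), analytic on the closed unit disc, with W(0) = C, W(w) unitary
    for |w| = 1, and W(w)^* = W(conj w). By the mean value property <f o C, g>
    is the average over |w| = 1 of <f o W(w), g>, which by unitary invariance
    is the average of <f, g o W(conj w)>, that is, <f, g o C>. Unitary
    invariance itself follows from translation invariance by evaluating a
    double integral in two ways, as in the uniqueness of Haar measure.

    Conversely, C = 0 in the symmetry gives <1, h> = <1, h(0)> for all h. So if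
    the operator is self-adjoint then <U, g> = <conj U(0), g> for all g and U
    is constant; when it is nonzero, comparing both sides on the coordinate
    functions, which are orthogonal with equal norms, gives C = C^*. *)

From HB Require Import structures.
Require Import Defs.
From mathcomp Require Import all_boot all_order all_algebra.
From mathcomp Require Import spectral sesquilinear complex.
From mathcomp Require Import all_classical all_reals all_analysis.
From mathcomp Require Import measurable_realfun ring lra.
Set Implicit Arguments.
Unset Strict Implicit.
Unset Printing Implicit Defensive.
Import Order.TTheory GRing.Theory Num.Theory.
Import numFieldNormedType.Exports.
Local Open Scope classical_set_scope.
Local Open Scope complex_scope.
Local Open Scope sesquilinear_scope.
Local Open Scope ring_scope.

(** * Measurability without a Borel structure on the target *)

(** The pairing of f o C with g cannot be moved to the other side by a change of variables, since C
    may be singular or fail to preserve the measure; unitary matrices do not have this defect, hence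
    the analytic family through C with unitary boundary values. Absolute convergence over circle
    times C^n follows from uv <= u^2 + v^2 and unitary invariance, with a bound uniform on the
    circle, so that no estimate of f o C itself enters. The mean value property is proved for real
    parts, by bisection in the coordinates w = exp(s + i t): circles become vertical segments, and
    independence of the radius is the vanishing of the circulation of Im(F(w) dw/w) around
    rectangles. Imaginary parts come back through the factor - i. Unitary invariance is hidden in a
    product of 2n real lines; the double integral needs an invariant reference function with finite
    nonzero integral, and the radial density itself serves. The converse uses neither reproducing
    kernels nor power series: constants and coordinates suffice, and the Gram matrix of the latter
    follows from two unitary symmetries, a sign change and a transposition. *)

(* ['cV[R[i]]_n] carries no sigma-algebra; being a pointwise limit of maps with
   countable range makes [f \o v] measurable for every continuous [f]. *)
Definition approximable d (X : measurableType d) (T : topologicalType)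
    (v : X -> T) : Prop :=
  exists (e : nat -> X -> nat) (p : nat -> nat -> T),
    (forall k, measurable_fun setT (e k)) /\
    (forall x, p k (e k x) @[k --> \oo] --> v x).

Lemma measurable_fun_nat d (X : measurableType d) (e : X -> nat) :
  (forall n, measurable (e @^-1` [set n])) -> measurable_fun setT e.
Proof.
move=> me _ A _; rewrite setTI.
have -> : e @^-1` A = \bigcup_(n in A) e @^-1` [set n].
  by apply/seteqP; split => [x Ax|x [n An] /= exn]; [exists (e x)|rewrite /= exn].
by apply: bigcup_measurable => n _; exact: me.
Qed.

Lemma measurable_fun_nat2 d (X : measurableType d) (e1 e2 : X -> nat)
    (g : nat -> nat -> nat) :
  measurable_fun setT e1 -> measurable_fun setT e2 ->
  measurable_fun setT (fun x => g (e1 x) (e2 x)).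
Proof.
move=> m1 m2; apply: measurable_fun_nat => n.
have -> : (fun x => g (e1 x) (e2 x)) @^-1` [set n] =
    \bigcup_i \bigcup_(j in [set j | g i j = n])
      (e1 @^-1` [set i] `&` e2 @^-1` [set j]).
  apply/seteqP; split => [x /= gn|x [i _] [j /= gn [/= -> ->]]//].
  by exists (e1 x) => //; exists (e2 x).
apply: bigcupT_measurable => i; apply: bigcup_measurable => j _.
by apply: measurableI; rewrite -[X in measurable X]setTI;
  [apply: m1|apply: m2].
Qed.

Lemma approximable_measurable d (X : measurableType d) (T : topologicalType)
    (R : realType) (v : X -> T) (f : T -> R) :
  approximable v -> continuous f -> measurable_fun setT (f \o v).
Proof.
move=> [e [p [me pv]]] cf.
apply: (@measurable_fun_cvg _ _ _ _ (fun k x => f (p k (e k x)))) => [k|x _].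
  exact: (@measurableT_comp _ _ _ _ _ _ (f \o p k)).
exact: (cvg_comp _ _ (pv x) (cf (v x))).
Qed.

Lemma approximable_comp d (X : measurableType d) (T T' : topologicalType)
    (v : X -> T) (h : T -> T') :
  continuous h -> approximable v -> approximable (h \o v).
Proof.
move=> ch [e [p [me pv]]]; exists e, (fun k => h \o p k); split=> // x.
exact: (cvg_comp _ _ (pv x) (ch (v x))).
Qed.

Lemma approximable_precomp d d' (X : measurableType d) (Y : measurableType d')
    (T : topologicalType) (v : X -> T) (g : Y -> X) :
  measurable_fun setT g -> approximable v -> approximable (v \o g).
Proof.
move=> mg [e [p [me pv]]]; exists (fun k => e k \o g), p; split=> [k|x].
  exact: measurableT_comp.
exact: pv.
Qed.

(** Two indices are packed into one natural number by [pickle], so that the range stays countable;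
    the [None] branch is never reached. *)
Lemma approximable_pair d (X : measurableType d) (T T' : topologicalType)
    (v : X -> T) (w : X -> T') :
  approximable v -> approximable w -> approximable (fun x => (v x, w x)).
Proof.
move=> [e [p [me pv]]] [e' [p' [me' pw]]].
exists (fun k x => pickle (e k x, e' k x)),
  (fun k m => if unpickle m is Some ij then (p k ij.1, p' k ij.2)
              else (p k 0%N, p' k 0%N)).
split=> [k|x]; first exact: (measurable_fun_nat2 (fun i j => pickle (i, j)) (me k) (me' k)).
apply: (@cvg_trans _ ((p k (e k x), p' k (e' k x)) @[k --> \oo])).
  by apply: near_eq_cvg; apply: nearW => k; rewrite pickleK.
exact: cvg_pair.
Qed.

Lemma approximable_const d (X : measurableType d) (T : topologicalType)
    (a : T) : approximable (fun _ : X => a).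
Proof.
exists (fun _ _ => 0%N), (fun _ _ => a); split=> [k|x]; first exact: measurable_cst.
exact: cvg_cst.
Qed.

(** The real x is rounded down to the grid of step 1/(k+1); [k.+1] avoids a division by 0 at k =
    0. *)
Lemma approximable_id (R : realType) :
  approximable (fun x : measurableTypeR R => (x : R)).
Proof.
exists (fun k x => pickle (Num.floor (k.+1%:R * x))),
  (fun k m => if unpickle m is Some z then z%:~R / k.+1%:R else 0).
split=> [k|x]; last first.
  rewrite /= (_ : (fun k => _) = (fun k => (Num.floor (k.+1%:R * x))%:~R / k.+1%:R));
    last by apply/funext => k; rewrite pickleK.
  apply: (@squeeze_cvgr _ _ _ _ (fun k => x - k.+1%:R^-1) (fun=> x));
      last 1 first.
  - exact: cvg_cst.
  - near=> k.
    have k0 : (0 : R) < k.+1%:R by rewrite ltr0n.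
    rewrite ler_pdivrMr// [x * _]mulrC floor_le andbT.
    rewrite ler_pdivlMr// mulrBl mulVf ?gt_eqF// [x * _]mulrC lerBlDr.
    by have /ltW := floorD1_gt (k.+1%:R * x); rewrite intrD.
  - rewrite -[X in _ --> X]subr0; apply: cvgB; first exact: cvg_cst.
    exact: (@cvg_harmonic R).
apply: measurable_fun_nat => n.
case En : (unpickle n : option int) => [z|]; last first.
  rewrite (_ : _ @^-1` _ = set0) //; apply/seteqP; split => // x /= xn.
  by move: En; rewrite -xn pickleK.
(* [unpickle] need not be injective: a number that decodes to z without being [pickle z] is never a
   value, so its fibre is empty. *)
case: (eqVneq (pickle z) n) => [zn|zn]; last first.
  rewrite (_ : _ @^-1` _ = set0) //; apply/seteqP; split => // x /= xn.
  by move: En; rewrite -xn pickleK => -[E]; rewrite -E xn eqxx in zn.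
rewrite (_ : _ @^-1` _ = `[z%:~R / k.+1%:R, (z + 1)%:~R / k.+1%:R[%classic) //.
have k0 : (0 : R) < k.+1%:R by rewrite ltr0n.
apply/seteqP; split => x /=; rewrite in_itv/=.
  rewrite -zn => /(pcan_inj pickleK) <-.
  by rewrite ler_pdivrMr// ltr_pdivlMr// [x * _]mulrC floor_le floorD1_gt.
rewrite ler_pdivrMr// ltr_pdivlMr// [x * _]mulrC => /andP[z1 z2].
by rewrite -zn; congr pickle; apply: floor_def; rewrite z1.
Unshelve. all: by end_near. Qed.

(** * Lebesgue measure on C^n *)

(* The library puts these structures on [R[i]^o] only. *)
HB.instance Definition _ (R : rcfType) := PseudoPointedMetric.copy R[i] R[i]^o.
HB.instance Definition _ (R : rcfType) := GRing.ComAlgebra.copy R[i] R[i]^o.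
HB.instance Definition _ (R : rcfType) := Vector.copy R[i] R[i]^o.
HB.instance Definition _ (R : rcfType) := NormedModule.copy R[i] R[i]^o.

(** * Convergence in [R[i]] and in matrices, by real and imaginary parts and by entries *)

Section ComplexTopology.
Variable R : realType.
Implicit Types z : R[i].

Lemma abs_Re_le z : `|complex.Re z| <= complex.Re `|z|.
Proof.
case: z => a b; rewrite normc_def /=.
by rewrite -sqrtr_sqr ler_wsqrtr// lerDl sqr_ge0.
Qed.

Lemma abs_Im_le z : `|complex.Im z| <= complex.Re `|z|.
Proof.
case: z => a b; rewrite normc_def /=.
by rewrite -sqrtr_sqr ler_wsqrtr// lerDr sqr_ge0.
Qed.

Lemma Re_normC_ge0 z : 0 <= complex.Re `|z|.
Proof. by case: z => a b; rewrite normc_def /= sqrtr_ge0. Qed.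

Lemma normCE z : `|z| = (complex.Re `|z|)%:C.
Proof. by case: z => a b; rewrite normc_def. Qed.

Lemma Re_normC_le z : complex.Re `|z| <= `|complex.Re z| + `|complex.Im z|.
Proof.
case: z => a b; rewrite normc_def /= -(@ler_pXn2r _ 2)// ?nnegrE ?sqrtr_ge0//.
rewrite sqr_sqrtr ?addr_ge0 ?sqr_ge0// sqrrD !real_normK ?num_real//.
by rewrite lerD2r lerDl mulrn_wge0// mulr_ge0.
Qed.

Lemma continuous_ReC : continuous (@complex.Re R : R[i] -> R).
Proof.
move=> z; apply/(cvgrPdist_lt (F := nbhs z)) => e e0; apply/nbhs_ballP.
exists (e%:C); first by rewrite /= ltcR.
move=> y; rewrite /ball /= => yz.
rewrite -raddfB; apply: le_lt_trans (abs_Re_le _) _.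
by rewrite -ltcR -normCE.
Qed.

Lemma continuous_ImC : continuous (@complex.Im R : R[i] -> R).
Proof.
move=> z; apply/(cvgrPdist_lt (F := nbhs z)) => e e0; apply/nbhs_ballP.
exists (e%:C); first by rewrite /= ltcR.
move=> y; rewrite /ball /= => yz.
rewrite -raddfB; apply: le_lt_trans (abs_Im_le _) _.
by rewrite -ltcR -normCE.
Qed.

Lemma cvg_complex (T : Type) (F : set_system T) {FF : Filter F} (f g : T -> R)
    (a b : R) :
  f x @[x --> F] --> a -> g x @[x --> F] --> b ->
  (f x +i* g x : R[i]) @[x --> F] --> (a +i* b : R[i]).
Proof.
move=> fa gb; apply/cvgrPdist_lt => -[e e'] /=.
rewrite ltcE /= => /andP[/eqP -> e0].
have e20 : 0 < e / 2 by rewrite divr_gt0.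
move/cvgrPdist_lt: fa => /(_ _ e20) fa; move/cvgrPdist_lt: gb => /(_ _ e20) gb.
near=> x; rewrite normCE ltcR; apply: le_lt_trans (Re_normC_le _) _ => /=.
by rewrite (splitr e) ltrD//; near: x.
Unshelve. all: by end_near. Qed.

Lemma cvg_mx (T : Type) (F : set_system T) {FF : Filter F} m n
    (f : T -> 'M[R[i]]_(m, n)) (M : 'M[R[i]]_(m, n)) :
  (forall i j, f x i j @[x --> F] --> M i j) -> f x @[x --> F] --> M.
Proof.
move=> fM A [P MP PA].
have : \forall x \near F, forall i j, P i j (f x i j).
  apply: filter_forall => i; apply: filter_forall => j.
  exact: (fM i j _ (MP i j)).
by apply: filterS => x Px; apply: PA.
Qed.

Lemma continuous_conjC : continuous (fun z : R[i] => z^*).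
Proof.
move=> z; rewrite (_ : (fun _ => _) = fun z => complex.Re z +i* - complex.Im z);
  last by apply/funext => -[].
apply: (cvg_complex (F := nbhs z)); first exact: continuous_ReC.
by apply: cvgN; exact: continuous_ImC.
Qed.

End ComplexTopology.

(** Rectangles built from two covering sequences are enumerated by [pickle]. Sigma-finiteness of the
    first factor is a hypothesis and not a structure, so that the recursion of [Cn_space] can supply
    it. *)
Lemma product_sigma_finite d1 d2 (T1 : measurableType d1)
    (T2 : measurableType d2) (R : realType) (m1 : {measure set T1 -> \bar R})
    (m2 : {sigma_finite_measure set T2 -> \bar R}) :
  sigma_finite setT m1 -> sigma_finite setT (m1 \x m2)%E.
Proof.
move=> [F TF mF]; have [G TG mG] := sigma_finiteT m2.
exists (fun k => if unpickle k is Some ij then F ij.1 `*` G ij.2 else set0).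
  apply/seteqP; split => // -[x y] _.
  have [i _ Fx] : (\bigcup_i F i) x by rewrite -TF.
  have [j _ Gy] : (\bigcup_i G i) y by rewrite -TG.
  by exists (pickle (i, j)) => //; rewrite pickleK.
move=> k; case: (unpickle k : option (nat * nat)) => [[i j]|]; last first.
  by rewrite measure0; split.
have [Fi Fioo] := mF i; have [Gj Gjoo] := mG j.
split; first exact: measurableX.
by rewrite [ltLHS]product_measure1E// lte_mul_pinfty// ge0_fin_numE.
Qed.

Section Volume.
Variable R : realType.

Lemma sigma_finite_Cn n : sigma_finite setT (ms_measure (Cn_space R n)).
Proof.
elim: n => [|n IH] /=; first exact: sigma_finiteT.
apply: product_sigma_finite; exact: product_sigma_finite.
Qed.

(** A name to which the sigma-finite structure can be attached; [Cn_space] itself only delivers a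
    bare measure. *)
Definition vol n : set (ms_carrier (Cn_space R n)) -> \bar R :=
  ms_measure (Cn_space R n).
HB.instance Definition _ n := Measure.on (@vol n).
HB.instance Definition _ n :=
  @Measure_isSigmaFinite.Build _ _ R (@vol n) (sigma_finite_Cn n).

Lemma volS n :
  @vol n.+1 = (@vol n \x @lebesgue_measure R \x @lebesgue_measure R)%E.
Proof. by []. Qed.

Lemma approximable_vecC n : approximable (@vecC R n).
Proof.
elim: n => [|n IH]; first exact: approximable_const.
pose h (p : 'cV[R[i]]_n * R * R) : 'cV[R[i]]_(1 + n) :=
  col_mx (p.1.2 +i* p.2)%:M p.1.1.
have ch : continuous h.
  move=> p; apply: cvg_mx => i j.
  rewrite /h; case: (split_ordP i) => k ->.
    rewrite col_mxEu !ord1 mxE eqxx mulr1n.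
    under eq_fun do rewrite col_mxEu mxE eqxx mulr1n.
    apply: cvg_complex.
      by apply: (@cvg_comp _ _ _ fst snd); [exact: cvg_fst|exact: cvg_snd].
    exact: cvg_snd.
  rewrite col_mxEd; under eq_fun do rewrite col_mxEd.
  apply: (@cvg_comp _ _ _ (fun x => x.1.1) (fun M : 'cV[R[i]]_n => M k j) _
    (nbhs p.1.1)); last exact: coord_continuous.
  by apply: (@cvg_comp _ _ _ fst fst); exact: cvg_fst.
apply: (@approximable_comp _ _ _ _
  (fun x : ms_carrier (Cn_space R n.+1) => (vecC x.1.1, x.1.2, x.2)) h ch).
apply: approximable_pair; first apply: approximable_pair.
- apply: (@approximable_precomp _ _ _ _ _ _ (fst \o fst));
    last exact: IH.
  exact: measurableT_comp.
- apply: (@approximable_precomp _ _ _ _ _ (@idfun R) (snd \o fst)).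
    exact: measurableT_comp.
  exact: approximable_id.
- apply: (@approximable_precomp _ _ _ _ _ (@idfun R) snd) => //.
  exact: approximable_id.
Qed.

End Volume.

(** Turns a proof of sigma-finiteness into a structure, for the intermediate product of C^n with a
    single real line. *)
Definition with_sigma_finite d (T : measurableType d) (R : realType)
    (mu : {measure set T -> \bar R}) of sigma_finite setT mu : set T -> \bar R :=
  mu.

Section SigmaFiniteInstance.
Variables (d : measure_display) (T : measurableType d) (R : realType).
Variables (mu : {measure set T -> \bar R}) (h : sigma_finite setT mu).
HB.instance Definition _ := Measure.on (with_sigma_finite h).
HB.instance Definition _ :=
  @Measure_isSigmaFinite.Build _ _ R (with_sigma_finite h) h.
End SigmaFiniteInstance.

(** * Translation invariance on C^n *)

Section Translation.
Variable R : realType.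
Local Open Scope ereal_scope.

(** The image of Lebesgue measure under the shift agrees with it on half-open intervals, hence
    everywhere by uniqueness. *)
Lemma ge0_integral_shift (a : R) (F : measurableTypeR R -> \bar R) :
  measurable_fun setT F -> (forall x, 0 <= F x) ->
  \int[@lebesgue_measure R]_x F (x + a)%R = \int[@lebesgue_measure R]_x F x.
Proof.
move=> mF F0.
pose s : measurableTypeR R -> measurableTypeR R := fun x => (x + a)%R.
have ms : measurable_fun setT s by exact: measurable_funD.
have E := @ge0_integral_pushforward _ _ _ _ R s ms
  (@lebesgue_measure R) setT F measurableT mF (fun y _ => F0 y).
rewrite preimage_setT in E; rewrite -[LHS]E.
apply: eq_measure_integral => A mA _; apply/esym.
apply: (lebesgue_measure_unique (mu := pushforward lebesgue_measure s)) => //.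
move=> X [[b c] /= _ <-]; rewrite /pushforward.
have -> : s @^-1` `]b, c] = `](b - a)%R, (c - a)%R]%classic.
  by apply/seteqP; split => x /=; rewrite !in_itv/= ltrBlDr lerBrDr.
rewrite !lebesgue_measure_itv/= !lte_fin ltrD2r.
by rewrite -!EFinD; case: ifP => // _; congr EFin; ring.
Qed.

Definition preserves_integral d (T : measurableType d)
    (m : set T -> \bar R) (tau : T -> T) :=
  forall F : T -> \bar R, measurable_fun setT F -> (forall x, 0 <= F x) ->
    \int[m]_x F (tau x) = \int[m]_x F x.

Lemma preserves_integral_shift d (T : measurableType d)
    (m : {sigma_finite_measure set T -> \bar R}) (tau : T -> T) (a : R) :
  measurable_fun setT tau -> preserves_integral m tau ->
  preserves_integral (m \x @lebesgue_measure R)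
    (fun z => (tau z.1, (z.2 + a)%R)).
Proof.
move=> mtau itau F mF F0.
have msh : measurable_fun setT
    (fun z : T * measurableTypeR R => (tau z.1, (z.2 + a)%R)).
  apply: measurable_fun_pair; first exact: measurableT_comp.
  exact: measurable_funD.
rewrite (fubini_tonelli1 (m2 := @lebesgue_measure R) (F \o _)); last 2 first.
- exact: measurableT_comp.
- by move=> x; exact: F0.
rewrite (fubini_tonelli1 (m2 := @lebesgue_measure R) F mF F0).
rewrite -[RHS]itau; last 2 first.
- exact: measurable_fun_fubini_tonelli_F.
- by move=> x; exact: integral_ge0.
apply: eq_integral => x _; rewrite /fubini_F /=.
apply: (ge0_integral_shift a (F := fun y => F (tau x, y))) => //.
exact: measurable_fun_pair2.
Qed.

(** The measure lives on the product of lines, so the translation is realized by a map [tau] there;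
    each complex coordinate contributes two one-dimensional shifts. *)
Lemma vecC_translation n (a : 'cV[R[i]]_n) :
  exists tau : ms_carrier (Cn_space R n) -> ms_carrier (Cn_space R n),
    [/\ measurable_fun setT tau, forall x, vecC (tau x) = (vecC x + a)%R &
      preserves_integral (@vol R n) tau].
Proof.
elim: n a => [|n IH] a.
  by exists id; split => // x; apply/matrixP => -[].
have [tau [mtau vtau itau]] := IH (dsubmx (a : 'cV[R[i]]_(1 + n))).
pose c : R[i] := (a : 'cV[R[i]]_(1 + n)) (lshift n 0%R) 0%R.
exists (fun x => (tau x.1.1, (x.1.2 + complex.Re c)%R, (x.2 + complex.Im c)%R)).
have m1 : measurable_fun setT (fun x : ms_carrier (Cn_space R n.+1) => x.1.1).
  exact: measurableT_comp.
have m2 : measurable_fun setT (fun x : ms_carrier (Cn_space R n.+1) => x.1.2).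
  exact: measurableT_comp.
have mtau' : measurable_fun setT (fun x : ms_carrier (Cn_space R n.+1) =>
   ((tau x.1.1, (x.1.2 + complex.Re c)%R, (x.2 + complex.Im c)%R)
     : ms_carrier (Cn_space R n.+1))).
  apply: measurable_fun_pair; first apply: measurable_fun_pair.
  - exact: measurableT_comp.
  - exact: measurable_funD.
  - exact: measurable_funD.
split=> //.
- move=> x.
  have E : ((x.1.2 +i* x.2)%:M + usubmx (a : 'cV_(1 + n)) =
      ((x.1.2 + complex.Re c) +i* (x.2 + complex.Im c))%:M)%R.
    apply/matrixP => i j; rewrite !ord1 !mxE eqxx !mulr1n /c.
    by case: (a _ _).
  transitivity (col_mx ((x.1.2 +i* x.2)%:M + usubmx (a : 'cV_(1 + n)))
    (vecC x.1.1 + dsubmx (a : 'cV_(1 + n)))); last first.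
    by rewrite -add_col_mx vsubmxK.
  by rewrite E -vtau.
- have m3 : measurable_fun setT
      (fun z : ms_carrier (Cn_space R n) * measurableTypeR R =>
        (tau z.1, (z.2 + complex.Re c)%R)).
    apply: measurable_fun_pair; first exact: measurableT_comp.
    exact: measurable_funD.
  pose m : {sigma_finite_measure set _ -> \bar R} := with_sigma_finite
    (product_sigma_finite (@lebesgue_measure R) (sigma_finiteT (@vol R n))).
  have H1 : preserves_integral m
      (fun z : ms_carrier (Cn_space R n) * measurableTypeR R =>
        (tau z.1, (z.2 + complex.Re c)%R)).
    exact: preserves_integral_shift.
  exact (@preserves_integral_shift _ _ m _ (complex.Im c) m3 H1).
Qed.

End Translation.

(** * Invariance under linear bijections *)

Lemma comp_continuous (T U V : topologicalType) (h : T -> U) (k : U -> V) :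
  continuous h -> continuous k -> continuous (k \o h).
Proof. by move=> ch ck x; exact: (continuous_comp (ch x) (ck (h x))). Qed.
Arguments comp_continuous {T U V h k} ch ck x.

Section ContinuousIntegrals.
Variables (R : realType) (n : nat).
Implicit Types f g : 'cV[R[i]]_n -> R.
Local Notation X := (ms_carrier (Cn_space R n)).

Lemma measurable_vecC f : continuous f -> measurable_fun setT (f \o @vecC R n).
Proof. exact/approximable_measurable/approximable_vecC. Qed.

Lemma measurable_vecC2 (F : 'cV[R[i]]_n * 'cV[R[i]]_n -> R) :
  continuous F -> measurable_fun setT (fun p : X * X => F (vecC p.1, vecC p.2)).
Proof.
move=> cF; apply: (@approximable_measurable _ _ _ _
  (fun p : X * X => (vecC p.1, vecC p.2)) F) => //.
apply: approximable_pair.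
  by apply: (@approximable_precomp _ _ _ _ _ _ fst) => //; exact: approximable_vecC.
by apply: (@approximable_precomp _ _ _ _ _ _ snd) => //; exact: approximable_vecC.
Qed.

Local Open Scope ereal_scope.

Lemma eintCE (f : 'cV[R[i]]_n -> \bar R) :
  eintC f = \int[@vol R n]_x f (vecC x).
Proof. by []. Qed.

Lemma eintC_shift f (a : 'cV[R[i]]_n) : continuous f -> (forall z, (0 <= f z)%R) ->
  eintC (fun z => (f (z + a)%R)%:E) = eintC (EFin \o f).
Proof.
move=> cf f0; have [tau [mtau vtau itau]] := vecC_translation a.
have mf : measurable_fun setT (EFin \o (f \o @vecC R n)).
  by apply: measurableT_comp => //; exact: measurable_vecC.
rewrite /eintC -[RHS](itau _ mf); last by move=> x; rewrite lee_fin /= f0.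
by apply: eq_integral => x _ /=; rewrite vtau.
Qed.

Variable L : 'cV[R[i]]_n -> 'cV[R[i]]_n.
Hypotheses (cL : continuous L) (LD : {morph L : x y / (x + y)%R}).
Hypothesis L_surj : forall a, exists b, L b = a.

(* Both [eintC f] and [eintC (f \o L)] are translation invariant in [f], so
   that the double integral of g(Ly) f(x + Ly) can be computed by shifting
   either x or y. *)
Lemma eintC_swap f g : continuous f -> continuous g ->
  (forall z, (0 <= f z)%R) -> (forall z, (0 <= g z)%R) ->
  eintC (EFin \o f) * eintC (fun z => (g (L z))%:E) =
  eintC (fun z => (f (L z))%:E) * eintC (fun z => (g (- z)%R)%:E).
Proof.
move=> cf cg f0 g0.
have cfL : continuous (f \o L) by exact: (comp_continuous cL cf).
have cgL : continuous (g \o L) by exact: (comp_continuous cL cg).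
have cgN : continuous (g \o -%R).
  have cN : continuous (-%R : 'cV[R[i]]_n -> 'cV[R[i]]_n).
    by move=> z; exact: (cvgN cvg_id).
  exact: (comp_continuous cN cg).
have mf := measurable_vecC cf; have mfL := measurable_vecC cfL.
have mg := measurable_vecC cg; have mgL := measurable_vecC cgL.
have mgN := measurable_vecC cgN.
pose F1 (p : 'cV[R[i]]_n * 'cV[R[i]]_n) : R := (g (L p.2) * f (p.1 + L p.2))%R.
pose F2 (p : 'cV[R[i]]_n * 'cV[R[i]]_n) : R := (g (L p.2 - p.1) * f (L p.2))%R.
have cL2 : continuous (fun p : 'cV[R[i]]_n * 'cV[R[i]]_n => L p.2).
  apply: (comp_continuous (h := snd) _ cL) => p; exact: cvg_snd.
have cF1 : continuous F1.
  have c1 : continuous (fun p : 'cV[R[i]]_n * 'cV[R[i]]_n => p.1 + L p.2)%R.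
    by move=> p; exact: (cvgD cvg_fst (cL2 p)).
  rewrite /F1 => p; exact: (cvgM (comp_continuous cL2 cg p)
    (comp_continuous c1 cf p)).
have cF2 : continuous F2.
  have c1 : continuous (fun p : 'cV[R[i]]_n * 'cV[R[i]]_n => L p.2 - p.1)%R.
    by move=> p; exact: (cvgB (cL2 p) cvg_fst).
  rewrite /F2 => p; exact: (cvgM (comp_continuous c1 cg p)
    (comp_continuous cL2 cf p)).
have mF1 := measurable_vecC2 cF1.
have mF2 := measurable_vecC2 cF2.
have F10 p : (0 <= F1 p)%R by exact: mulr_ge0.
have F20 p : (0 <= F2 p)%R by exact: mulr_ge0.
transitivity (\int[@vol R n]_y \int[@vol R n]_x (F1 (vecC x, vecC y))%:E).
  rewrite [LHS]muleC [X in X * _]eintCE -ge0_integralZr; last 4 first.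
  - exact: measurableT.
  - exact: measurableT_comp.
  - by move=> x _; rewrite lee_fin /= ?(f0, g0).
  - by apply: integral_ge0 => x _; rewrite lee_fin /= ?(f0, g0).
  apply: eq_integral => y _; rewrite -(eintC_shift (L (vecC y)) cf f0).
  rewrite eintCE -ge0_integralZl; last 4 first.
  - exact: measurableT.
  - apply: measurableT_comp => //; apply: (measurable_vecC (f := fun z => f (z + L (vecC y))%R)).
    have ch : continuous (fun z : 'cV[R[i]]_n => z + L (vecC y))%R.
      by move=> z; exact: (cvgD cvg_id (cvg_cst _)).
    exact: (comp_continuous ch cf).
  - by move=> x _; rewrite lee_fin /= ?(f0, g0).
  - by rewrite lee_fin /= ?(f0, g0).
  by apply: eq_integral => x _; rewrite /F1 EFinM.
transitivity (\int[@vol R n]_x \int[@vol R n]_y (F1 (vecC x, vecC y))%:E).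
  apply: (fubini_tonelli (m1 := @vol R n) (m2 := @vol R n)
    (fun p => (F1 (vecC p.2, vecC p.1))%:E)) => [|p]; last by rewrite lee_fin.
  apply: measurableT_comp => //.
  apply: (measurable_vecC2 (F := fun p => F1 (p.2, p.1))).
  have ch : continuous (fun p : 'cV[R[i]]_n * 'cV[R[i]]_n => (p.2, p.1)).
    by move=> p; exact: (cvg_pair cvg_snd cvg_fst).
  exact: (comp_continuous ch cF1).
transitivity (\int[@vol R n]_x \int[@vol R n]_y (F2 (vecC x, vecC y))%:E).
  (* Translating y by this b changes L y into L y - x in both factors: f loses its dependence on x
     and g acquires one. *)
  apply: eq_integral => x _; have [b Lb] := L_surj (- vecC x)%R.
  pose h z := F1 (vecC x, z).
  have ch : continuous h.
    have ch : continuous (fun z : 'cV[R[i]]_n => (vecC x, z)).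
      move=> z; exact: (cvg_pair (cvg_cst (vecC x) (F := nbhs z)) cvg_id).
    exact: (comp_continuous ch cF1).
  rewrite -[LHS](eintC_shift b ch (fun z => F10 _)) eintCE.
  apply: eq_integral => y _; congr EFin.
  by rewrite /h /F1 /F2 /= LD Lb addrCA subrr addr0.
transitivity (\int[@vol R n]_y \int[@vol R n]_x (F2 (vecC x, vecC y))%:E).
  apply: (fubini_tonelli (m1 := @vol R n) (m2 := @vol R n)
    (fun p => (F2 (vecC p.1, vecC p.2))%:E)) => [|p]; last by rewrite lee_fin.
  exact: measurableT_comp.
rewrite [X in _ = X * _]eintCE -ge0_integralZr; last 4 first.
- exact: measurableT.
- exact: measurableT_comp.
- by move=> x _; rewrite lee_fin /= ?(f0, g0).
- by apply: integral_ge0 => x _; rewrite lee_fin /= ?(f0, g0).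
apply: eq_integral => y _; rewrite -(eintC_shift (- L (vecC y))%R cgN); last by move=> z; exact: g0.
rewrite eintCE -ge0_integralZl; last 4 first.
- exact: measurableT.
- apply: measurableT_comp => //.
  apply: (measurable_vecC (f := fun z => g (- (z - L (vecC y)))%R)).
  have ch : continuous (fun z : 'cV[R[i]]_n => z - L (vecC y))%R.
    by move=> z; exact: (cvgB cvg_id (cvg_cst _)).
  exact: (comp_continuous ch cgN).
- by move=> x _; rewrite lee_fin /= ?(f0, g0).
- by rewrite lee_fin /= ?(f0, g0).
by apply: eq_integral => x _; rewrite /F2 /= opprB mulrC EFinM.
Qed.

(** In the swap identity, an even and L-invariant g makes the two integrals of g equal; being finite
    and nonzero they cancel, which forces the Jacobian factor of L to be 1. *)
Lemma eintC_invariant f g : continuous f -> (forall z, (0 <= f z)%R) ->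
  continuous g -> (forall z, (0 <= g z)%R) ->
  (forall z, g (L z) = g z) -> (forall z, g (- z)%R = g z) ->
  0 < eintC (EFin \o g) < +oo ->
  eintC (fun z => (f (L z))%:E) = eintC (EFin \o f).
Proof.
move=> cf f0 cg g0 gL gN /andP[Ig0 Igoo].
have E1 : (fun z => (g (L z))%:E) = EFin \o g by apply/funext => z /=; rewrite gL.
have E2 : (fun z => (g (- z)%R)%:E) = EFin \o g by apply/funext => z /=; rewrite gN.
have := eintC_swap cf cg f0 g0; rewrite E1 E2.
have Igf : eintC (EFin \o g) \is a fin_num by rewrite ge0_fin_numE // ltW.
by move=> E; apply/le_anti/andP; split; rewrite -(lee_pmul2r Igf Ig0) E.
Qed.

End ContinuousIntegrals.

(** * The mean value property *)

Section Goursat.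
Variable R : realType.

Lemma max_of_four (x y z t : R) :
  exists i : bool * bool, `|x + y + (z + t)| / 4 <=
    `|match i with (false, false) => x | (true, false) => y
      | (false, true) => z | (true, true) => t end|.
Proof.
pose m : R := `|x + y + (z + t)| / 4.
have [hx|hx] := lerP m `|x|; first by exists (false, false).
have [hy|hy] := lerP m `|y|; first by exists (true, false).
have [hz|hz] := lerP m `|z|; first by exists (false, true).
exists (true, true); rewrite -/m leNgt; apply/negP => ht.
have h1 := ler_normD (x + y) (z + t); have h2 := ler_normD x y.
have h3 := ler_normD z t.
have : `|x + y + (z + t)| = 4 * m by rewrite /m mulrC divfK.
lra.
Qed.

Variable Q : R -> R -> R -> R -> R.
Hypothesis Q_hsplit : forall m a b c d, Q a b c d = Q a m c d + Q m b c d.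
Hypothesis Q_vsplit : forall m a b c d, Q a b c d = Q a b c m + Q a b m d.

Let quarter (i : bool * bool) (r : R * R * (R * R)) : R * R * (R * R) :=
  let half (i : bool) (u : R * R) :=
    if i then ((u.1 + u.2) / 2, u.2) else (u.1, (u.1 + u.2) / 2) in
  (half i.1 r.1, half i.2 r.2).

Let q r := Q r.1.1 r.1.2 r.2.1 r.2.2.

Let quarter_choice r : {r' | exists2 i, r' = quarter i r & `|q r| / 4 <= `|q r'|}.
Proof.
apply: cid; case: r => -[a b] [c d].
pose m := (a + b) / 2; pose k := (c + d) / 2.
have := max_of_four (Q a m c k) (Q m b c k) (Q a m k d) (Q m b k d).
rewrite -!Q_hsplit -Q_vsplit => -[i hi]; exists (quarter i ((a, b), (c, d))).
by exists i => //; apply: le_trans hi _; case: i => -[] [].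
Qed.

Lemma nested_intervals (u : nat -> R * R) :
  (forall k, (u k).1 <= (u k).2) ->
  (forall k, (u k).1 <= (u k.+1).1) -> (forall k, (u k.+1).2 <= (u k).2) ->
  exists s, forall k, (u k).1 <= s <= (u k).2.
Proof.
move=> u12 u1 u2.
have m1 j k : (j <= k)%N -> (u j).1 <= (u k).1.
  by move=> /subnKC <-; elim: (k - j)%N => [|i IH]; rewrite ?addn0// addnS (le_trans IH).
have m2 j k : (j <= k)%N -> (u k).2 <= (u j).2.
  by move=> /subnKC <-; elim: (k - j)%N => [|i IH]; rewrite ?addn0// addnS (le_trans _ IH).
have ub j k : (u j).1 <= (u k).2.
  apply: le_trans (m1 _ _ (leq_maxl j k)) (le_trans (u12 _) _).
  exact: m2 (leq_maxr j k).
exists (sup (range (fun k => (u k).1))) => k; apply/andP; split.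
  apply: ub_le_sup; last by exists k.
  by exists (u 0%N).2 => _ [j _ <-]; exact: ub.
by apply: ge_sup; [exists (u 0%N).1, 0%N|move=> _ [j _ <-]; exact: ub].
Qed.

(* Goursat's argument, for any additive function of rectangles. *)
Lemma goursat_bisection (a b c d : R) : a <= b -> c <= d ->
  (forall s t, a <= s <= b -> c <= t <= d -> forall e, 0 < e ->
    exists2 del, 0 < del & forall a' b' c' d',
      a <= a' -> a' <= s <= b' -> b' <= b ->
      c <= c' -> c' <= t <= d' -> d' <= d ->
      b' - a' < del -> d' - c' < del ->
      `|Q a' b' c' d'| <= e * ((b' - a') + (d' - c')) ^+ 2) ->
  Q a b c d = 0.
Proof.
move=> ab cd loc; apply/eqP/negPn/negP => Q0.
have eta0 : 0 < `|Q a b c d| by rewrite normr_gt0.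
have [f [f0 fS]] := dependent_choice quarter_choice ((a, b), (c, d)).
(* The ratio of side lengths at stage k. The value of |Q| loses at most a factor 4 = 2^2 per stage,
   hence the square of [w k] in the invariant. *)
pose w (k : nat) : R := (2 ^+ k)^-1.
have wS k : w k.+1 = w k / 2 by rewrite /w exprS invfM mulrC.
have inv k : [/\ (f k).1.2 - (f k).1.1 = (b - a) * w k,
   (f k).2.2 - (f k).2.1 = (d - c) * w k &
   `|Q a b c d| * w k ^+ 2 <= `|q (f k)|].
  elim: k => [|k [I1 I2 I3]].
    by rewrite f0 /w /= expr0 invr1 !mulr1 expr1n mulr1.
  have [[i j] -> hq] := fS k; rewrite wS; split.
  - rewrite mulrA -I1; case: (i) => /=; lra.
  - rewrite mulrA -I2; case: (j) => /=; lra.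
  - have -> : `|Q a b c d| * (w k / 2) ^+ 2 = (`|Q a b c d| * w k ^+ 2) / 4.
      by field.
    by apply: le_trans hq; rewrite ler_pM2r// invr_gt0.
have w0 k : 0 < w k by rewrite invr_gt0 exprn_gt0.
have le1 k : (f k).1.1 <= (f k).1.2.
  by have [I1 _ _] := inv k; rewrite -subr_ge0 I1 mulr_ge0 ?subr_ge0// ltW.
have le2 k : (f k).2.1 <= (f k).2.2.
  by have [_ I2 _] := inv k; rewrite -subr_ge0 I2 mulr_ge0 ?subr_ge0// ltW.
have mon k : [/\ (f k).1.1 <= (f k.+1).1.1, (f k.+1).1.2 <= (f k).1.2,
    (f k).2.1 <= (f k.+1).2.1 & (f k.+1).2.2 <= (f k).2.2].
  have [[i j] -> _] := fS k; have := le1 k; have := le2 k.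
  by case: i; case: j => /=; split; lra.
have [s hs] : exists s, forall k, (f k).1.1 <= s <= (f k).1.2.
  by apply: (nested_intervals le1) => k; have [] := mon k.
have [t ht] : exists t, forall k, (f k).2.1 <= t <= (f k).2.2.
  by apply: (nested_intervals le2) => k; have [] := mon k.
have bnd k : [/\ a <= (f k).1.1, (f k).1.2 <= b, c <= (f k).2.1 & (f k).2.2 <= d].
  elim: k => [|k [h1 h2 h3 h4]]; first by rewrite f0.
  have [g1 g2 g3 g4] := mon k.
  by split; [exact: le_trans g1|exact: le_trans g2 _|exact: le_trans g3|
    exact: le_trans g4 _].
pose D := (b - a) + (d - c).
have D0 : 0 <= D by rewrite addr_ge0// subr_ge0.
have sab : a <= s <= b by have := hs 0%N; rewrite f0.
have tcd : c <= t <= d by have := ht 0%N; rewrite f0.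
(* Small enough for e * D^2 < |Q a b c d|, the final contradiction; the summand 1 covers D = 0. *)
pose e := `|Q a b c d| / (2 * (D ^+ 2 + 1)).
have D1 : 0 < D ^+ 2 + 1 by rewrite ltr_wpDl// sqr_ge0.
have e0 : 0 < e by rewrite divr_gt0// mulr_gt0.
have [del del0 hdel] := loc s t sab tcd e e0.
have [k hk] : exists k, D * w k < del.
  have : (D * w k) @[k --> \oo] --> (D * 0 : R).
    apply: cvgMr; rewrite (_ : w = (fun k => 2^-1 ^+ k)); last first.
      by apply/funext => k; rewrite /w exprVn.
    apply: cvg_expr; rewrite ger0_norm ?invr_ge0// invf_lt1 ?ltr0n//.
    by rewrite ltr1n.
  rewrite mulr0 => /cvgrPdist_lt /(_ _ del0) [k _ /(_ k (leqnn k))].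
  rewrite /= sub0r normrN ger0_norm; first by exists k.
  by rewrite mulr_ge0// ltW.
have [I1 I2 I3] := inv k; have [b1 b2 b3 b4] := bnd k.
have ba0 : 0 <= b - a by rewrite subr_ge0.
have dc0 : 0 <= d - c by rewrite subr_ge0.
have := hdel _ _ _ _ b1 (hs k) b2 b3 (ht k) b4.
rewrite I1 I2 -mulrDl -/D => /(_ _ _)/(le_trans I3) H.
have {}H : `|Q a b c d| * w k ^+ 2 <= e * (D * w k) ^+ 2.
  apply: H; apply: le_lt_trans hk; rewrite ler_pM2r//.
    by rewrite lerDl.
  by rewrite lerDr.
have w2 : 0 < w k ^+ 2 by rewrite exprn_gt0.
have {}H : `|Q a b c d| <= e * D ^+ 2.
  by rewrite -(ler_pM2r w2) -mulrA -exprMn.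
move: H; rewrite /e => H.
have : `|Q a b c d| / (2 * (D ^+ 2 + 1)) * D ^+ 2 < `|Q a b c d|.
  rewrite -mulrA -[ltRHS]mulr1 ltr_pM2l// mulrC ltr_pdivrMr ?mulr_gt0// mul1r.
  have := sqr_ge0 D; lra.
by rewrite ltNge H.
Qed.

End Goursat.

(** * Moduli and complex differentiability with real bounds *)

Section ComplexAbs.
Variable R : realType.
Implicit Types z w : R[i].

(** The norm of [R[i]] takes its values in [R[i]]; this version lives in [R], whose order is
    total. *)
Definition cabs z : R := complex.Re `|z|.

Lemma cabsE z : `|z| = (cabs z)%:C. Proof. exact: normCE. Qed.

Lemma cabs_ge0 z : 0 <= cabs z. Proof. exact: Re_normC_ge0. Qed.

Lemma cabsM z w : cabs (z * w) = cabs z * cabs w.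
Proof. by apply: complexI; rewrite rmorphM /= -!cabsE normrM. Qed.

Lemma cabsD z w : cabs (z + w) <= cabs z + cabs w.
Proof. by rewrite -lecR rmorphD /= -!cabsE ler_normD. Qed.

Lemma cabs_conj z : cabs z^* = cabs z.
Proof. by apply: complexI; rewrite -!cabsE norm_conjC. Qed.

Lemma cabs_real (x : R) : cabs x%:C = `|x|.
Proof. by rewrite /cabs normc_def /= expr0n addr0 sqrtr_sqr. Qed.

Lemma cabs0 : cabs 0 = 0. Proof. by rewrite /cabs normr0. Qed.

(** The form of complex differentiability that the bisection argument consumes: an affine
    approximation with error controlled by real constants. *)
Definition cdiff_at (F : R[i] -> R[i]) w : Prop :=
  exists a, forall e : R, 0 < e -> exists2 d : R, 0 < d &
    forall v, cabs (v - w) < d -> cabs (F v - F w - a * (v - w)) <= e * cabs (v - w).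

Lemma near_cabs w (P : R[i] -> Prop) (d : R) : 0 < d ->
  (forall v, cabs (v - w) < d -> P v) -> \forall v \near w, P v.
Proof.
move=> d0 dP; apply/nbhs_ballP; exists d%:C; first by rewrite /= ltcR.
move=> v; rewrite /ball /= => wv; apply: dP.
by rewrite -ltcR -cabsE distrC.
Qed.

Lemma cdiff_at_continuous (F : R[i] -> R[i]) w :
  cdiff_at F w -> {for w, continuous F}.
Proof.
move=> [a Fa]; have [d d0 Fd] := Fa 1 ltr01.
apply/(cvgrPdist_lt (F := nbhs w)) => e'; case: e' => e ?.
rewrite ltcE /= => /andP[/eqP -> e0].
have k0 : 0 < 1 + cabs a by rewrite ltr_pwDl// cabs_ge0.
apply: (near_cabs (d := Num.min d (e / (1 + cabs a)))).
  by rewrite lt_min d0 divr_gt0.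
move=> v; rewrite lt_min => /andP[vd ve].
rewrite distrC cabsE ltcR.
have -> : F v - F w = (F v - F w - a * (v - w)) + a * (v - w) by rewrite subrK.
apply: le_lt_trans (cabsD _ _) _; rewrite cabsM.
move: ve; rewrite ltr_pdivlMr// mulrC => ve.
by apply: le_lt_trans ve; rewrite mulrDl lerD2r; exact: Fd.
Qed.

End ComplexAbs.

(** * Primitives of continuous functions *)

Section Primitive.
Variable R : realType.
Implicit Types f phi Phi : R -> R.

(** The base point A is kept strictly below the points of interest, so that derivatives are
    two-sided there. *)
Definition primitive (A : R) f (x : R) : R :=
  \int[@lebesgue_measure R]_(t in `[A, x]) f t.

Lemma is_derive_primitive (A : R) f (x : R) : continuous f -> A < x ->
  is_derive x 1 (primitive A f) (f x).
Proof.
move=> cf Ax.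
have int_f : lebesgue_measure.-integrable `[A, x + 1] (EFin \o f).
  apply: continuous_compact_integrable; first exact: segment_compact.
  exact: continuous_subspaceT.
have x1 : x < x + 1 by rewrite ltrDl.
have [dP <-] := continuous_FTC1 x1 int_f Ax (cf x).
by rewrite derive1E; exact: DeriveDef.
Qed.

(** The mean value theorem for [primitive A f - Phi]. It replaces the integral of f by the increment
    of an explicit [Phi], at a controlled cost. *)
Lemma primitive_bound f Phi phi (A a b M : R) : continuous f -> A < a -> a <= b ->
  (forall x : R, is_derive x 1 Phi (phi x)) ->
  (forall x, a <= x <= b -> `|f x - phi x| <= M) ->
  `|primitive A f b - primitive A f a - (Phi b - Phi a)| <= M * (b - a).
Proof.
move=> cf Aa ab dPhi hM.
have dD (x : R) : A < x ->
    is_derive x 1 (primitive A f - Phi) (f x - phi x).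
  by move=> Ax; apply: is_deriveB; exact: is_derive_primitive.
have cD : {within `[a, b], continuous (primitive A f - Phi)}.
  apply: derivable_within_continuous => x; rewrite in_itv /= => /andP[ax _].
  by have [] := dD x (lt_le_trans Aa ax).
have dD' x : x \in `]a, b[ -> is_derive x 1 (primitive A f - Phi) (f x - phi x).
  by rewrite in_itv /= => /andP[ax _]; apply: dD; exact: lt_trans ax.
have [c cab Dc] := MVT_segment ab dD' cD.
have -> : primitive A f b - primitive A f a - (Phi b - Phi a) =
    (primitive A f - Phi) b - (primitive A f - Phi) a.
  by rewrite !fctE; ring.
rewrite Dc normrM [`|b - a|]ger0_norm ?subr_ge0// ler_wpM2r ?subr_ge0//.
by apply: hM; move: cab; rewrite in_itv.
Qed.

Lemma integral_primitive f (A a b : R) : continuous f -> A < a -> a < b ->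
  (\int[@lebesgue_measure R]_(x in `[a, b]) (f x)%:E)%E =
  (primitive A f b - primitive A f a)%:E.
Proof.
move=> cf Aa ab.
have dP (x : R) : a <= x -> derivable (primitive A f) x 1.
  by move=> ax; have [] := is_derive_primitive cf (lt_le_trans Aa ax).
have cP (x : R) : a <= x -> {for x, continuous (primitive A f)}.
  move=> ax; apply: differentiable_continuous.
  by apply/derivable1_diffP; exact: dP.
rewrite EFinB; apply: continuous_FTC2 => //.
- exact: continuous_subspaceT.
- split.
  + by move=> x; rewrite in_itv /= => /andP[/ltW ax _]; exact: dP.
  + by apply: cvg_at_right_filter; exact: cP.
  + by apply: cvg_at_left_filter; apply: cP; exact: ltW.
- move=> x; rewrite in_itv /= => /andP[ax _]; rewrite derive1E.
  by have [_ ->] := is_derive_primitive cf (lt_trans Aa ax).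
Qed.

End Primitive.

(** * Logarithmic polar coordinates and circulation around rectangles *)

Section Polar.
Variable R : realType.

(** This is exp(s + i t): s <= 0 describes the punctured closed unit disc, and the origin lies at s
    = -oo. *)
Definition polar (s t : R) : R[i] := (expR s * cos t) +i* (expR s * sin t).

Lemma cabs_polar s t : cabs (polar s t) = expR s.
Proof.
rewrite /cabs /polar normc_def /= !exprMn -mulrDr cos2Dsin2 mulr1.
by rewrite sqrtr_sqr ger0_norm ?expR_ge0.
Qed.

Lemma lip_of_derive (f df : R -> R) (M a b : R) :
  (forall x : R, is_derive x 1 f (df x)) ->
  (forall x, Num.min a b <= x <= Num.max a b -> `|df x| <= M) -> `|f b - f a| <= M * `|b - a|.
Proof.
move=> fd hM.
wlog ab : a b hM / a <= b.
  move=> W; have [ab|/ltW ba] := leP a b; first exact: W.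
  by rewrite distrC [`|b - a|]distrC; apply: W => // x; rewrite minC maxC; exact: hM.
have cf : {within `[a, b], continuous f}.
  by apply: derivable_within_continuous => x _; have [] := fd x.
have [c cab ->] := MVT_segment ab (fun x _ => fd x) cf.
rewrite normrM ler_wpM2r//; apply: hM; move: cab; rewrite in_itv /=.
by rewrite min_l// max_r.
Qed.

Lemma polar_lip s t s' t' : s <= 0 -> s' <= 0 ->
  cabs (polar s' t' - polar s t) <= 2 * (`|s' - s| + `|t' - t|).
Proof.
move=> s0 s'0.
(* The radius changes at angle t', and the angle at radius exp s; on s <= 0 the exponential is
   1-Lipschitz and bounded by 1. *)
have -> : polar s' t' - polar s t =
    (expR s' - expR s)%:C * polar 0 t' + (expR s)%:C * (polar 0 t' - polar 0 t).
  by rewrite /polar expR0 !mul1r; simpc; congr (_ +i* _); ring.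
apply: le_trans (cabsD _ _) _; rewrite !cabsM !cabs_real cabs_polar expR0 mulr1.
have e1 : `|expR s' - expR s| <= 1 * `|s' - s|.
  apply: (lip_of_derive (df := expR)) => x; rewrite le_max => /andP[_ /orP xs].
  rewrite ger0_norm ?expR_ge0// -[leRHS]expR0 ler_expR.
  by case: xs => xs; apply: le_trans xs _.
have e2 : `|expR s| <= 1 by rewrite ger0_norm ?expR_ge0// -[leRHS]expR0 ler_expR.
have e3 : cabs (polar 0 t' - polar 0 t) <= 2 * `|t' - t|.
  apply: le_trans (Re_normC_le _) _; rewrite /polar expR0 !mul1r /= mulr2n mulrDl.
  apply: lerD; rewrite mul1r -[leRHS]mul1r.
    apply: (lip_of_derive (df := fun x => - sin x)) => x _.
    by rewrite normrN ler_norml sin_geN1 sin_le1.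
  apply: (lip_of_derive (df := cos)) => x _.
  by rewrite ler_norml cos_geN1 cos_le1.
rewrite mulrDr; apply: lerD.
  by apply: le_trans e1 _; rewrite mul1r ler_peMl// ler1n.
by apply: le_trans (ler_piMl (cabs_ge0 _) e2) e3.
Qed.

(** Counterclockwise circulation around [a, b] x [c, d], where [P t] is a primitive along the
    horizontal line at height t and [Q s] one along the vertical line at abscissa s. Written with
    increments of primitives, it is additive by pure algebra. *)
Definition boundary_sum (P Q : R -> R -> R) (a b c d : R) : R :=
  (P c b - P c a) + (Q b d - Q b c) - (P d b - P d a) - (Q a d - Q a c).

Lemma boundary_sum_hsplit P Q m a b c d : boundary_sum P Q a b c d =
  boundary_sum P Q a m c d + boundary_sum P Q m b c d.
Proof. by rewrite /boundary_sum; ring. Qed.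

Lemma boundary_sum_vsplit P Q m a b c d : boundary_sum P Q a b c d =
  boundary_sum P Q a b c m + boundary_sum P Q a b m d.
Proof. by rewrite /boundary_sum; ring. Qed.

(** The increments of a single function [Phi] around the rectangle telescope to 0, so only the
    errors on the four sides remain. *)
Lemma boundary_sum_bound P Q (Phi : R -> R -> R) a b c d M N :
  `|P c b - P c a - (Phi b c - Phi a c)| <= M ->
  `|P d b - P d a - (Phi b d - Phi a d)| <= M ->
  `|Q b d - Q b c - (Phi b d - Phi b c)| <= N ->
  `|Q a d - Q a c - (Phi a d - Phi a c)| <= N ->
  `|boundary_sum P Q a b c d| <= M + N + M + N.
Proof.
rewrite !ler_norml /boundary_sum.
by move=> /andP[? ?] /andP[? ?] /andP[? ?] /andP[? ?]; apply/andP; split; lra.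
Qed.

Lemma boundary_sum_periodic P Q a b c d : P c = P d ->
  boundary_sum P Q a b c d = 0 -> Q b d - Q b c = Q a d - Q a c.
Proof. by rewrite /boundary_sum => ->; lra. Qed.

(** This lemma and the next serve, for complex constants a and c, to differentiate Im(a (s + i t) +
    c exp(s + i t)), a potential of the imaginary part of (a + c w) dw/w at w = exp(s + i t). *)
Lemma is_derive_potential1 (A B K x : R) :
  is_derive x 1 (fun x : R => A * x + B + expR x * K) (A + expR x * K).
Proof.
have D1 := is_deriveZ A (is_derive_id x (1 : R)).
have D2 := is_deriveZ K (is_derive_expR x).
have D := is_deriveD (is_deriveD D1 (is_derive_cst B x 1)) D2.
have -> : A + expR x * K = A *: 1 + 0 + K *: expR x.
  by rewrite addr0 [expR x * K]mulrC [A *: _]mulr1.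
have -> : (fun x : R => A * x + B + expR x * K) =
    (A \*: id + cst B + K \*: expR : R -> R).
  by apply/funext => y; rewrite [expR y * K]mulrC.
exact: D.
Qed.

Lemma is_derive_potential2 (A B E u v y : R) :
  is_derive y 1 (fun y : R => A + B * y + E * (u * sin y + v * cos y))
    (B + E * (u * cos y - v * sin y)).
Proof.
have D1 := is_deriveZ B (is_derive_id y (1 : R)).
have D2 := is_deriveZ E (is_deriveD (is_deriveZ u (is_derive_sin y))
  (is_deriveZ v (is_derive_cos y))).
have D := is_deriveD (is_deriveD (is_derive_cst A y 1) D1) D2.
have -> : B + E * (u * cos y - v * sin y) =
    0 + B *: 1 + E *: (u *: cos y + v *: - sin y).
  by rewrite add0r [B *: _]mulr1 [v *: _]mulrN.
exact: D.
Qed.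

End Polar.

(** * Goursat's argument for F(w) dw/w, and the mean over the unit circle *)

Section MeanValue.
Variable R : realType.
Variable F : R[i] -> R[i].
Hypothesis F_cdiff : forall w, cabs w <= 1 -> cdiff_at F w.

(* Clamping the logarithmic radius at 0 keeps the functions continuous
   everywhere, although nothing is known on [F] outside the unit disc. *)
Let G (s t : R) := F (polar (Num.min s 0) t).
Let p (t s : R) := complex.Im (G s t).
Let q (s t : R) := complex.Re (G s t).

Let cG (s t : R) : {for polar (Num.min s 0) t, continuous F}.
Proof.
apply/cdiff_at_continuous/F_cdiff; rewrite cabs_polar -[leRHS]expR0 ler_expR.
by rewrite ge_min lexx orbT.
Qed.

Let cp t : continuous (p t).
Proof.
have c1 : continuous (fun s : R => polar (Num.min s 0) t).
  move=> s; have ce : expR (Num.min x 0) @[x --> s] --> expR (Num.min s 0).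
    have cm : {for s, continuous (fun s : R => Num.min s 0)}.
      by apply: continuous_min; [exact: cvg_id|exact: cvg_cst].
    exact: (continuous_comp cm (@continuous_expR R _)).
  by apply: (cvg_complex (F := nbhs s)); apply: cvgMl.
move=> s; have c2 := continuous_comp (c1 s) (@cG s t).
exact: (continuous_comp c2 (@continuous_ImC R _)).
Qed.

Let cq s : continuous (q s).
Proof.
have c1 : continuous (polar (Num.min s 0)).
  move=> t; apply: (cvg_complex (F := nbhs t)); apply: cvgMr.
    exact: continuous_cos.
  exact: continuous_sin.
move=> t; have c2 := continuous_comp (c1 t) (@cG s t).
exact: (continuous_comp c2 (@continuous_ReC R _)).
Qed.

(* The integral of the 1-form Im F ds + Re F dt along the boundary of a
   rectangle; it is the imaginary part of the integral of F(w)/w dw. Its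
   vanishing makes the means of Re F over circles independent of the radius. *)
Let bdry (S : R) : R -> R -> R -> R -> R :=
  boundary_sum (fun t => primitive (S - 1) (p t))
    (fun s => primitive (- pi - 1) (q s)).

Let bdry_eq0 (S : R) : S <= 0 -> bdry S S 0 (- pi) pi = 0.
Proof.
move=> S0.
have pi0 : - pi <= pi :> R by rewrite ge0_cp ?pi_ge0.
apply: (goursat_bisection (boundary_sum_hsplit _ _)
  (boundary_sum_vsplit _ _) S0 pi0).
move=> s t /andP[Ss s0] /andP[t1 t2] e e0.
have minE (x : R) : x <= 0 -> Num.min x 0 = x by move=> x0; rewrite min_l.
have [al Fal] : cdiff_at F (polar s t).
  by apply: F_cdiff; rewrite cabs_polar -[leRHS]expR0 ler_expR.
(* [polar] is 2-Lipschitz and each side length occurs twice in the boundary: with e / 4 the errors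
   add up to e times the square of the half-perimeter. *)
have e4 : 0 < e / 4 by rewrite divr_gt0.
have [del del0 hdel] := Fal _ e4.
(* Sides below del / 4 give a half-perimeter below del / 2, and the Lipschitz constant 2 keeps the
   image within del of the centre. *)
exists (del / 4); first by rewrite divr_gt0.
move=> a b c d Sa /andP[ast sb] b0 pic /andP[ct td] dpi bad dcd.
(* F(w) is A + al * w up to a small error, and [Phi] below is a potential for the form attached to
   this affine part. *)
pose A := F (polar s t) - al * polar s t.
pose k x := complex.Re al * sin x + complex.Im al * cos x.
pose k' x := complex.Re al * cos x - complex.Im al * sin x.
pose Phi x y := complex.Im A * x + complex.Re A * y + expR x * k y.
pose T := (b - a) + (d - c).
have dPhi1 (y x : R) :
    is_derive x 1 (Phi^~ y) (complex.Im A + expR x * k y).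
  exact: is_derive_potential1.
have dPhi2 (x y : R) : is_derive y 1 (Phi x) (complex.Re A + expR x * k' y).
  exact: is_derive_potential2.
have close x y : a <= x <= b -> c <= y <= d ->
    cabs (G x y - (A + al * polar x y)) <= e / 4 * (2 * T).
  move=> /andP[ax xb] /andP[cy yd].
  have x0 : x <= 0 := le_trans xb b0.
  have hT : `|x - s| + `|y - t| <= T.
    by rewrite /T; apply: lerD; rewrite ler_norml; apply/andP; split; lra.
  have hp := le_trans (polar_lip t y s0 x0) (ler_wpM2l (ler0n _ 2) hT).
  have -> : G x y - (A + al * polar x y) =
      F (polar x y) - F (polar s t) - al * (polar x y - polar s t).
    by rewrite /G minE// /A; ring.
  apply: le_trans (hdel _ _) _; last by rewrite ler_pM2l.
  by apply: le_lt_trans hp _; rewrite /T; lra.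
have M0 : 0 <= e / 4 * (2 * T).
  by rewrite mulr_ge0 ?mulr_ge0 ?(ltW e4)// /T; lra.
have ReE x y : complex.Re (A + al * polar x y) = complex.Re A + expR x * k' y.
  by rewrite raddfD /= /polar /k'; case: (al) => u v /=; ring.
have ImE x y : complex.Im (A + al * polar x y) = complex.Im A + expR x * k y.
  by rewrite raddfD /= /polar /k; case: (al) => u v /=; ring.
have hP y : c <= y <= d -> `|primitive (S - 1) (p y) b - primitive (S - 1) (p y) a -
    (Phi b y - Phi a y)| <= e / 4 * (2 * T) * (b - a).
  move=> cyd; apply: primitive_bound (dPhi1 y) _ => //; [lra|lra|].
  move=> x axb; apply: le_trans (close x y axb cyd).
  by rewrite -ImE /p -raddfB; exact: abs_Im_le.
have hQ x : a <= x <= b -> `|primitive (- pi - 1) (q x) d -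
    primitive (- pi - 1) (q x) c - (Phi x d - Phi x c)| <= e / 4 * (2 * T) * (d - c).
  move=> axb; apply: primitive_bound (dPhi2 x) _ => //; [lra|lra|].
  move=> y cyd; apply: le_trans (close x y axb cyd).
  by rewrite -ReE /q -raddfB; exact: abs_Re_le.
have ab : a <= b := le_trans ast sb.
have cd : c <= d := le_trans ct td.
have := hP c; have := hP d; have := hQ a; have := hQ b.
rewrite !lexx ab cd => /(_ isT) h1 /(_ isT) h2 /(_ isT) h3 /(_ isT) h4.
have -> : e * (b - a + (d - c)) ^+ 2 = e / 4 * (2 * T) * (b - a) +
   e / 4 * (2 * T) * (d - c) + e / 4 * (2 * T) * (b - a) +
   e / 4 * (2 * T) * (d - c) by rewrite /T; field.
exact: (boundary_sum_bound (P := fun t => primitive (S - 1) (p t))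
  (Q := fun s => primitive (- pi - 1) (q s)) h4 h3 h1 h2).
Qed.

(** The sides t = -pi and t = pi cancel by periodicity, so the integral of Re F over the circle of
    radius exp s, with respect to the angle, is the same for all s <= 0. Small circles and
    continuity at 0 identify it. *)
Lemma mean_value :
  (\int[@lebesgue_measure R]_(t in `[(- pi)%R, pi])
     (complex.Re (F (cos t +i* sin t)))%:E)%E = (2 * pi * complex.Re (F 0))%:E.
Proof.
have pi0 : - pi < pi :> R by rewrite gt0_cp// pi_gt0.
have A1 : - pi - 1 < - pi :> R by rewrite gtrBl.
have q0E : q 0 = fun t => complex.Re (F (cos t +i* sin t)).
  by apply/funext => t; rewrite /q /G minxx /polar expR0 !mul1r.
transitivity (\int[@lebesgue_measure R]_(t in `[(- pi)%R, pi]) (q 0 t)%:E)%E.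
  by rewrite q0E.
rewrite (integral_primitive (@cq 0) A1 pi0); congr EFin.
pose Q s := primitive (- pi - 1) (q s).
have QE (S : R) : S <= 0 -> Q 0 pi - Q 0 (- pi) = Q S pi - Q S (- pi).
  move=> S0; apply: (boundary_sum_periodic _ (bdry_eq0 S0)).
  by congr primitive; apply/funext => s; rewrite /p /G /polar cosN sinN sinpi oppr0.
apply/eqP/negPn/negP => neq.
pose e : R := `|Q 0 pi - Q 0 (- pi) - 2 * pi * complex.Re (F 0)|.
have e0 : 0 < e by rewrite normr_gt0 subr_eq0.
have pp : 0 < 2 * pi :> R by rewrite mulr_gt0// pi_gt0.
have e1 : 0 < e / (2 * pi) / 2 by rewrite !divr_gt0.
have [a Fa] : cdiff_at F 0 by apply: F_cdiff; rewrite cabs0.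
have [d d0 hd] := Fa 1 ltr01.
have k0 : 0 < 1 + cabs a by rewrite ltr_pwDl// cabs_ge0.
(* For |w| < x, Re F(w) differs from Re F(0) by at most half of e / (2 pi); integrating over a
   length 2 pi gives the contradiction e <= e / 2. *)
pose x := Num.min d (e / (2 * pi) / 2 / (1 + cabs a)).
have x0 : 0 < x by rewrite lt_min d0 divr_gt0.
pose S : R := Num.min 0 (ln (x / 2)).
have S0 : S <= 0 by rewrite ge_min lexx.
have Sx : expR S < x.
  apply: (@le_lt_trans _ _ (x / 2)); last by rewrite ltr_pdivrMr// ltr_pMr// ltr1n.
  by rewrite -[leRHS]lnK ?posrE ?divr_gt0// ler_expR ge_min lexx orbT.
have close y : `|q S y - complex.Re (F 0)| <= e / (2 * pi) / 2.
  rewrite -raddfB; apply: le_trans (abs_Re_le _) _.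
  rewrite -/(cabs _) /G min_l//; set w := polar S y.
  have wx : cabs w < x by rewrite cabs_polar.
  have := hd w; rewrite subr0 => hw.
  have -> : F w - F 0 = (F w - F 0 - a * w) + a * w by rewrite subrK.
  apply: le_trans (cabsD _ _) _; rewrite cabsM.
  move: wx; rewrite lt_min => /andP[wd]; rewrite ltr_pdivlMr// => wy.
  apply: le_trans (ltW wy); rewrite [leRHS]mulrC mulrDl lerD2r; exact: hw.
have dPhi (y : R) : is_derive y 1 (complex.Re (F 0) \*: (@id R)) (complex.Re (F 0) *: 1).
  exact: is_deriveZ.
have := primitive_bound (a := - pi) (b := pi) (M := e / (2 * pi) / 2) (@cq S) A1
  (ltW pi0) dPhi.
rewrite -/(Q S) -(QE S S0) => H.
have {}H : e <= e / (2 * pi) / 2 * (pi - - pi).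
  rewrite {1}/e (_ : 2 * pi * complex.Re (F 0) = (complex.Re (F 0) \*: (@id R)) pi -
    (complex.Re (F 0) \*: (@id R)) (- pi)).
    apply: H => y _; rewrite [_ *: _]mulr1; exact: close.
  by rewrite /= /GRing.scale /=; ring.
have E : e / (2 * pi) / 2 * (pi - - pi) = e / 2.
  rewrite opprK (_ : e / (2 * pi) / 2 * (pi + pi) = e / (2 * pi) * (2 * pi) / 2).
    by rewrite divfK// gt_eqF.
  by ring.
by move: H; rewrite E; lra.
Qed.

End MeanValue.

(** * Radial weights *)

Section HalfLineDerivative.
Variable R : realType.
Implicit Types (f psi : R -> R) (x : R).

Lemma hderivable_is_derive f x : 0 < x -> hderivable f x ->
  is_derive x 1 f (hderive f x).
Proof.
move=> x0 fx.
have E : hfilter x = 0^'.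
  apply/funext => A; apply/propext; split; rewrite /hfilter /within /=.
    move=> H; have Dn : \forall h \near 0^', 0 <= x + h.
      rewrite near_withinE; apply/nbhs_ballP; exists x => // h.
      rewrite /ball /= sub0r normrN => /ltW; rewrite ler_norml => /andP[xh _] _.
      by rewrite addrC -lerBlDr sub0r.
    by apply: filterS2 H Dn => h; apply.
  by apply: filterS => h Ah _.
have E2 : (fun h : R => h^-1 *: (f (h *: 1 + x) - f x)) = hquotient f x.
  by apply/funext => h; rewrite /hquotient [_ *: 1]mulr1 [h + x]addrC.
by apply: DeriveDef; rewrite /derivable /derive E2 -E.
Qed.

Lemma hderivable_continuous f x : hderivable f x ->
  forall e, 0 < e -> exists2 d, 0 < d &
    forall y, 0 <= y -> `|y - x| < d -> `|f y - f x| < e.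
Proof.
move=> /cvg_ex[/= l fl] e e0.
have : \forall h \near hfilter x, `|l - hquotient f x h| < 1.
  by move/cvgrPdist_lt: fl => /(_ _ ltr01).
rewrite /hfilter near_withinE => /nbhs_ballP[d /= d0 hd].
have k0 : 0 < 1 + `|l| by rewrite ltr_pwDl.
exists (Num.min d (e / (1 + `|l|))); first by rewrite lt_min d0 divr_gt0.
move=> y y0; rewrite lt_min => /andP[yd ye].
have [->|yx] := eqVneq y x; first by rewrite subrr normr0.
have /hd : ball 0 d (y - x) by rewrite /ball /= sub0r normrN.
rewrite subr_eq0 => /(_ yx); rewrite /= addrC subrK => /(_ y0).
rewrite /hquotient [x + _]addrC subrK => hq.
have yx0 : y - x != 0 by rewrite subr_eq0.
have -> : f y - f x = (y - x) * ((y - x)^-1 * (f y - f x)) by rewrite mulVKf.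
rewrite normrM; apply: le_lt_trans (_ : `|y - x| * (1 + `|l|) < _).
  apply: ler_wpM2l => //; rewrite -lerBlDr.
  by apply: ltW; apply: le_lt_trans hq; rewrite distrC; exact: lerB_dist.
by rewrite -ltr_pdivlMr.
Qed.

Lemma hderive_ge_increment f (a b : R) : 0 < a -> a <= b ->
  (forall x, 0 <= x -> hderivable f x) -> forall M,
  (forall x, a <= x -> M <= hderive f x) -> M * (b - a) <= f b - f a.
Proof.
move=> a0 ab fd M hM.
have D x : x \in `]a, b[ -> is_derive x 1 f (hderive f x).
  rewrite in_itv /= => /andP[ax _]; have x0 := lt_trans a0 ax.
  by apply: hderivable_is_derive => //; apply/fd/ltW.
have cf : {within `[a, b], continuous f}.
  apply: derivable_within_continuous => x; rewrite in_itv /= => /andP[ax _].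
  have x0 := lt_le_trans a0 ax.
  by have [] := hderivable_is_derive x0 (fd x (ltW x0)).
have [c cab ->] := MVT_segment ab D cf.
rewrite ler_wpM2r ?subr_ge0//; apply: hM.
by move: cab; rewrite in_itv /= => /andP[].
Qed.

(** By convexity [psi] lies above its tangent at 1, which has positive slope and a nonnegative value
    at 1. The tangent is taken at 1 and not at 0 to work with two-sided derivatives; for y <= 1 the
    bound is nonpositive. *)
Lemma weight_growth n psi : is_weight n psi -> exists2 c : R, 0 < c &
  forall y : R, 0 <= y -> c * (y - 1) <= psi y.
Proof.
move=> [psi0 [psiD _] psiS _].
have [c0 _ _] := psiS 1 ler01.
exists (hderive psi 1) => // y y0; have [y1|/ltW y1] := leP 1 y; last first.
  by apply: le_trans (psi0 y y0); rewrite mulr_ge0_le0 ?subr_le0// ltW.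
have := hderive_ge_increment ltr01 y1 (psiD 0%N isT) (M := hderive psi 1).
rewrite lerBrDr => H; apply: le_trans (H _) => [|x x1].
  by rewrite lerDl psi0.
have := hderive_ge_increment ltr01 x1 (psiD 1%N isT) (M := 0).
rewrite mul0r subr_ge0; apply => u u1.
by have [] := psiS u (le_trans ler01 u1).
Qed.

End HalfLineDerivative.

(** * Gaussian integrals on C^n *)

Section GaussianIntegral.
Variable R : realType.

Lemma cabs_sqr (z : R[i]) : cabs z ^+ 2 = complex.Re z ^+ 2 + complex.Im z ^+ 2.
Proof.
by case: z => a b; rewrite /cabs normc_def /= sqr_sqrtr// addr_ge0 ?sqr_ge0.
Qed.

Lemma sqnormCE n (z : 'cV[R[i]]_n) :
  sqnormC z = \sum_(j < n) (complex.Re (z j 0) ^+ 2 + complex.Im (z j 0) ^+ 2).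
Proof.
rewrite /sqnormC /dotC raddf_sum; apply: eq_bigr => j _.
by case: (z j 0) => a b /=; ring.
Qed.

Lemma sqnormC_ge0 n (z : 'cV[R[i]]_n) : 0 <= sqnormC z.
Proof. by rewrite sqnormCE sumr_ge0// => j _; rewrite addr_ge0 ?sqr_ge0. Qed.

Lemma continuous_sum (K : numFieldType) (V : normedModType K)
    (T : topologicalType) (I : Type) (r : seq I) (f : I -> T -> V) :
  (forall i, continuous (f i)) -> continuous (fun z => \sum_(i <- r) f i z).
Proof.
move=> cf; elim: r => [|i r IH] z.
  by rewrite (_ : (fun _ => _) = cst 0) ?funeqE => [|x]; [exact: cvg_cst|rewrite big_nil].
rewrite (_ : (fun _ => _) = f i \+ fun z => \sum_(i <- r) f i z).
  exact: (cvgD (cf i z) (IH z)).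
by apply/funext => x; rewrite big_cons.
Qed.

Lemma continuous_sqnormC n : continuous (@sqnormC R n).
Proof.
rewrite (_ : @sqnormC R n = fun z =>
  \sum_(j < n) (complex.Re (z j 0) ^+ 2 + complex.Im (z j 0) ^+ 2)); last first.
  by apply/funext => z; exact: sqnormCE.
apply: continuous_sum => j z; apply: (cvgD (F := nbhs z)).
  have H := comp_continuous (@coord_continuous R[i] n 1 j 0) (@continuous_ReC R) z.
  exact: (cvgM H H).
have H := comp_continuous (@coord_continuous R[i] n 1 j 0) (@continuous_ImC R) z.
exact: (cvgM H H).
Qed.

Lemma vecC_ord0 n (x : ms_carrier (Cn_space R n.+1)) :
  vecC x ord0 0 = (x.1.2 +i* x.2).
Proof.
transitivity ((x.1.2 +i* x.2)%:M (0 : 'I_1) (0 : 'I_1)); last first.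
  by rewrite mxE eqxx mulr1n.
rewrite -(@col_mxEu _ 1 n 1 _ (vecC x.1.1)) /=.
by congr (fun_of_matrix _ _ _); apply/val_inj.
Qed.

Lemma vecC_lift n (x : ms_carrier (Cn_space R n.+1)) j :
  vecC x (lift ord0 j) 0 = vecC x.1.1 j 0.
Proof.
rewrite -(@col_mxEd _ 1 n 1 (x.1.2 +i* x.2)%:M (vecC x.1.1)) /=.
by congr (fun_of_matrix _ _ _); apply/val_inj.
Qed.

Lemma sqnormC_vecC n (x : ms_carrier (Cn_space R n.+1)) :
  sqnormC (vecC x) = x.1.2 ^+ 2 + x.2 ^+ 2 + sqnormC (vecC x.1.1).
Proof.
rewrite !sqnormCE [LHS]big_ord_recl vecC_ord0; congr (_ + _).
by apply: eq_bigr => j _; rewrite vecC_lift.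
Qed.

Local Open Scope ereal_scope.

Lemma integral_gauss_lty (k : R) : (0 < k)%R ->
  \int[@lebesgue_measure R]_x (expR (- (k * x ^+ 2)))%:E < +oo.
Proof.
(* With variance 1 / (2 k) the normal density is a multiple of exp(- k x^2). *)
move=> k0; pose s : R := Num.sqrt (2 * k)^-1.
have s0 : (0 < s)%R by rewrite sqrtr_gt0 invr_gt0 mulr_gt0.
have pk : (0 < normal_peak s)%R by rewrite normal_peak_gt0// gt_eqF.
have E : (fun x : R => (expR (- (k * x ^+ 2)))%:E) =
    (fun x => (normal_peak s)^-1%:E * (normal_pdf 0 s x)%:E).
  apply/funext => x; rewrite -EFinM normal_pdfE ?gt_eqF// mulKf ?gt_eqF//.
  rewrite /normal_fun subr0 sqr_sqrtr ?invr_ge0 ?mulr_ge0 ?ltW//.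
  by congr (expR _)%:E; field; rewrite gt_eqF.
rewrite E integralZl//; last exact: integrable_normal_pdf.
by rewrite integral_normal_pdf mule1 ltry.
Qed.

Lemma ge0_integral_prod d (T : measurableType d) (m : {sigma_finite_measure set T -> \bar R})
    (f : T -> R) (g : R -> R) :
  measurable_fun setT f -> measurable_fun setT g ->
  (forall x, (0 <= f x)%R) -> (forall y, (0 <= g y)%R) ->
  \int[m]_x (f x)%:E < +oo -> \int[@lebesgue_measure R]_y (g y)%:E < +oo ->
  \int[(m \x @lebesgue_measure R)]_z (f z.1 * g z.2)%:E < +oo.
Proof.
move=> mf mg f0 g0 If Ig.
rewrite (fubini_tonelli1 (m2 := @lebesgue_measure R)); last 2 first.
- apply: measurableT_comp => //; apply: measurable_funM.
    exact: (measurableT_comp mf).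
  exact: (measurableT_comp (f := g)).
- by move=> x; rewrite lee_fin mulr_ge0.
rewrite /fubini_F /=.
have -> : (fun x => \int[lebesgue_measure]_y (f x * g y)%:E) =
    (fun x => (f x)%:E * \int[@lebesgue_measure R]_y (g y)%:E).
  apply/funext => x; rewrite -ge0_integralZl//.
  - by apply: measurableT_comp.
  - by move=> y _; rewrite lee_fin.
  - by rewrite lee_fin.
rewrite ge0_integralZr//; last 3 first.
- by apply: measurableT_comp.
- by move=> x _; rewrite lee_fin.
- by apply: integral_ge0 => y _; rewrite lee_fin.
rewrite lte_mul_pinfty//; first by apply: integral_ge0 => y _; rewrite lee_fin.
by rewrite ge0_fin_numE//; apply: integral_ge0 => y _; rewrite lee_fin.
Qed.

End GaussianIntegral.

Section WeightIntegral.
Variable R : realType.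
Local Open Scope ereal_scope.

Lemma eintC_gauss_lty n (k : R) : (0 < k)%R ->
  eintC (fun z : 'cV[R[i]]_n => (expR (- (k * sqnormC z)))%:E) < +oo.
Proof.
move=> k0; elim: n => [|n IH].
  rewrite /eintC /= integral_dirac//= diracT mul1e ltry //.
have mg : measurable_fun setT (fun x : R => expR (- (k * x ^+ 2)))%R.
  apply: measurableT_comp => //; apply: measurable_funN.
  by apply: measurable_funM => //; exact: measurable_funX.
have mf : measurable_fun setT (fun x : ms_carrier (Cn_space R n) =>
    expR (- (k * sqnormC (vecC x))))%R.
  apply: measurableT_comp => //; apply: measurable_funN.
  apply: measurable_funM => //; apply: (measurable_vecC (f := @sqnormC R n)).
  exact: continuous_sqnormC.
pose m : {sigma_finite_measure set _ -> \bar R} := with_sigma_finite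
  (product_sigma_finite (@lebesgue_measure R) (sigma_finiteT (@vol R n))).
have H1 := ge0_integral_prod (m := @vol R n) mf mg (fun x => expR_ge0 _)
  (fun x => expR_ge0 _) IH (integral_gauss_lty k0).
have mf1 : measurable_fun setT
    (fun z : ms_carrier (Cn_space R n) * measurableTypeR R =>
      expR (- (k * sqnormC (vecC z.1))) * expR (- (k * z.2 ^+ 2)))%R.
  apply: measurable_funM; first exact: (measurableT_comp mf).
  exact: (measurableT_comp (f := fun x : R => expR (- (k * x ^+ 2)))%R).
have := ge0_integral_prod (m := m) mf1 mg (fun x => mulr_ge0 (expR_ge0 _) (expR_ge0 _))
  (fun x => expR_ge0 _) H1 (integral_gauss_lty k0).
apply: le_lt_trans; rewrite /eintC le_eqVlt; apply/orP; left; apply/eqP.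
apply: eq_integral => x _; rewrite sqnormC_vecC -!expRD.
by congr (expR _)%:E; ring.
Qed.

(** A box of intervals in the product of lines stands in for a neighbourhood of z, with
    measurability and volume at hand. *)
Lemma ball_vol_gt0 n (z : 'cV[R[i]]_n) (e : R) : (0 < e)%R ->
  exists2 A, measurable A & 0 < @vol R n A /\
    forall x, A x -> forall j, (cabs (vecC x j 0 - z j 0)%R < e)%R.
Proof.
move=> e0; elim: n z => [|n IH] z.
  exists setT => //; split; last by move=> x _ [].
  by rewrite /vol /= diracT lte01.
have [A mA [A0 hA]] := IH (dsubmx (z : 'cV[R[i]]_(1 + n))).
pose c := (z : 'cV[R[i]]_(1 + n)) (lshift n 0%R) 0%R : R[i].
(* Half-width e / 2, because a modulus is bounded by the sum of |Re| and |Im|. *)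
pose J (a : R) : set (measurableTypeR R) := `](a - e / 2)%R, (a + e / 2)%R[%classic.
have mJ a : measurable (J a) by exact: measurable_itv.
have J0 a : 0 < @lebesgue_measure R (J a).
  rewrite lebesgue_measure_itv /= lte_fin ltrBlDr -addrA ltrDl.
  by rewrite addr_gt0 ?divr_gt0// -EFinD lte_fin; lra.
exists (A `*` J (complex.Re c) `*` J (complex.Im c)).
  exact: measurableX (measurableX mA (mJ _)) (mJ _).
split.
  rewrite volS [ltRHS]product_measure1E//; last exact: measurableX.
  have H : 0 < (@vol R n \x @lebesgue_measure R) (A `*` J (complex.Re c)).
    rewrite [ltRHS]product_measure1E//; exact: (mule_gt0 A0 (J0 _)).
  exact: (mule_gt0 H (J0 _)).
move=> x [[/= Ax1 x2] x3] j.
case: (unliftP ord0 j) => [k ->|->].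
  rewrite vecC_lift (_ : z _ _ = dsubmx (z : 'cV[R[i]]_(1 + n)) k 0%R).
    exact: hA.
  by rewrite mxE; congr (fun_of_matrix z _ _); apply/val_inj.
rewrite vecC_ord0 (_ : z _ _ = c); last first.
  by rewrite /c; congr (fun_of_matrix z _ _); apply/val_inj.
move: x2 x3; rewrite /J /= !in_itv /= => /andP[u1 u2] /andP[u3 u4].
apply: le_lt_trans (Re_normC_le _) _; rewrite (splitr e); apply: ltrD.
  by rewrite raddfB /= ltr_norml; apply/andP; split; lra.
by rewrite raddfB /= ltr_norml; apply/andP; split; lra.
Qed.

(** If f z > 0, continuity gives f >= f z / 2 on a box around z, which has positive volume. *)
Lemma eintC_eq0 n (f : 'cV[R[i]]_n -> R) : continuous f ->
  (forall z, (0 <= f z)%R) -> eintC (EFin \o f) = 0 -> forall z, f z = 0%R.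
Proof.
move=> cf f0 If z; apply/eqP/negPn/negP => fz0.
have fz : (0 < f z)%R by rewrite lt_def fz0 f0.
have f2 : (0 < f z / 2)%R by rewrite divr_gt0.
have /(cvgrPdist_lt (F := nbhs z)) /(_ _ f2) := cf z.
move=> [P Pz hP].
have [e e0 he] : exists2 e : R, (0 < e)%R &
    forall y : 'cV[R[i]]_n, (forall j, (cabs (y j 0 - z j 0) < e)%R) ->
    forall i j, P i j (y i j).
  have [e []] : exists e : R, (0 < e)%R /\
      forall i c, (cabs (c - z i 0) < e)%R -> P i 0%R c.
    (* One radius must serve all coordinates: these are finitely many conditions, each valid for all
       small e > 0. *)
    apply: (@filter_ex _ (0%R : R)^'+); near=> e; split=> //.
    near: e; apply: filter_forall => i.
    have /nbhs_ballP[[d ?]] := Pz i 0%R.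
    rewrite /= ltcE /= => /andP[/eqP -> d0] hd.
    near=> e => c ce; apply: hd; rewrite /ball /= distrC cabsE ltcR.
    by apply: lt_le_trans ce _; near: e; exact: nbhs_right_le.
  move=> e0 he; exists e => // y hy i j.
  by rewrite (ord1 j); apply: he; exact: hy.
have [A mA [A0 hA]] := ball_vol_gt0 z e0.
have mf : measurable_fun setT (EFin \o f \o @vecC R n).
  by apply: measurableT_comp => //; exact: measurable_vecC.
have : (f z / 2)%:E * vol A <= eintC (EFin \o f).
  rewrite eintCE -integral_cst//.
  apply: (@le_trans _ _ (\int[@vol R n]_(x in A) (f (vecC x))%:E)).
    apply: ge0_le_integral => //.
    - by move=> x _; rewrite lee_fin ltW.
    - exact: measurable_funTS.
    - move=> x Ax; rewrite lee_fin.
      have := hP _ (he _ (hA x Ax)); rewrite /= ltr_norml => /andP[_].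
      by move: (f z) (f (vecC x)) => u v; lra.
  apply: ge0_subset_integral => //.
  by move=> x _; rewrite lee_fin f0.
by rewrite If leNgt mule_gt0.
Unshelve. all: by end_near. Qed.

End WeightIntegral.

(** * Continuity and integrability of the density *)

Section Weight.
Variables (R : realType) (n : nat) (psi : R -> R).
Hypothesis hpsi : is_weight n psi.
Local Notation V := 'cV[R[i]]_n.
Local Notation rho := (@density R n psi).

Lemma density_gt0 (z : V) : 0 < rho z. Proof. exact: expR_gt0. Qed.

Lemma density_ge0 (z : V) : 0 <= rho z. Proof. exact/ltW/density_gt0. Qed.

Lemma continuous_density : continuous rho.
Proof.
have cpsi : continuous (fun z : V => psi (sqnormC z)).
  move=> z; apply/(cvgrPdist_lt (F := nbhs z)) => e e0.
  have [_ [psiD _] _ _] := hpsi.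
  have [d d0 hd] := hderivable_continuous (psiD 0%N isT _ (sqnormC_ge0 z)) e0.
  have /(cvgrPdist_lt (F := nbhs z)) /(_ _ d0) := @continuous_sqnormC R n z.
  apply: filterS => y zy; rewrite distrC; apply: hd; first exact: sqnormC_ge0.
  by rewrite distrC.
have cpsiN : continuous (fun z : V => - psi (sqnormC z)).
  by move=> z; exact: (cvgN (cpsi z)).
exact: (comp_continuous cpsiN (@continuous_expR R)).
Qed.

Lemma continuous_moment : continuous (fun z : V => (1 + sqnormC z) * rho z).
Proof.
have c1 : continuous (fun z : V => 1 + sqnormC z).
  by move=> z; exact: (cvgD (cvg_cst (1 : R) (F := nbhs z))
    (@continuous_sqnormC R n z)).
by move=> z; exact: (cvgM (c1 z) (@continuous_density z)).
Qed.

(** Half of the exponential decay pays for the factor 1 + y: it is at most (1 + 2/c) (1 + c y / 2),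
    hence at most (1 + 2/c) exp(c y / 2). *)
Lemma density_bound : exists K k : R, [/\ 0 < K, 0 < k &
  forall z : V, (1 + sqnormC z) * rho z <= K * expR (- (k * sqnormC z))].
Proof.
have [c c0 hc] := weight_growth hpsi.
exists ((1 + 2 / c) * expR c), (c / 2); split.
- by rewrite mulr_gt0 ?expR_gt0// addr_gt0 ?divr_gt0.
- by rewrite divr_gt0.
move=> z; set y := sqnormC z; have y0 : 0 <= y := sqnormC_ge0 z.
have h1 : rho z <= expR c * expR (- (c / 2 * y)) * expR (- (c / 2 * y)).
  rewrite -!expRD ler_expR; have := hc y y0; lra.
have h2 : 1 + y <= (1 + 2 / c) * expR (c / 2 * y).
  apply: le_trans (_ : (1 + 2 / c) * (1 + c / 2 * y) <= _); last first.
    by rewrite ler_pM2l ?expR_ge1Dx// addr_gt0 ?divr_gt0.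
  have -> : (1 + 2 / c) * (1 + c / 2 * y) = 1 + y + (c / 2 * y + 2 / c).
    by field; rewrite gt_eqF.
  have c0' := ltW c0.
  by rewrite lerDl addr_ge0 ?mulr_ge0 ?divr_ge0 ?invr_ge0.
apply: le_trans (ler_pM _ (density_ge0 z) h2 h1) _; first by rewrite addr_ge0.
rewrite le_eqVlt; apply/orP; left; apply/eqP.
rewrite (_ : (1 + 2 / c) * expR (c / 2 * y) * _ = (1 + 2 / c) * expR c *
  (expR (c / 2 * y) * expR (- (c / 2 * y))) * expR (- (c / 2 * y))); last by ring.
by rewrite -[expR (c / 2 * y) * _]expRD subrr expR0 mulr1.
Qed.

Lemma eintC_moment_lty :
  (eintC (fun z : V => ((1 + sqnormC z) * rho z)%:E) < +oo)%E.
Proof.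
have [K [k [K0 k0 hK]]] := density_bound.
have cg : continuous (fun z : V => expR (- (k * sqnormC z))).
  have c1 : continuous (fun z : V => - (k * sqnormC z)).
    move=> z; exact: (cvgN (cvgM (cvg_cst k (F := nbhs z))
      (@continuous_sqnormC R n z))).
  exact: (comp_continuous c1 (@continuous_expR R)).
have mg := measurable_vecC cg; have m1 := measurable_vecC continuous_moment.
apply: (@le_lt_trans _ _ (K%:E * eintC (fun z : V => (expR (- (k * sqnormC z)))%:E))%E).
  rewrite !eintCE -ge0_integralZl//.
  - apply: ge0_le_integral => //.
    + by move=> x _; rewrite lee_fin mulr_ge0 ?density_ge0 ?addr_ge0 ?sqnormC_ge0.
    + exact: measurableT_comp.
    + by apply: measurable_funeM; exact: measurableT_comp.
    + by move=> x _; rewrite -EFinM lee_fin.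
  - exact: measurableT_comp.
  - by rewrite lee_fin ltW.
by rewrite lte_mul_pinfty ?lee_fin ?(ltW K0)// eintC_gauss_lty.
Qed.

Lemma eintC_le (f g : V -> R) : continuous f -> continuous g ->
  (forall z, 0 <= f z <= g z) ->
  (eintC (EFin \o f) <= eintC (EFin \o g))%E.
Proof.
move=> cf cg fg; rewrite !eintCE; apply: ge0_le_integral => //.
- by move=> x _; rewrite lee_fin; case/andP: (fg (vecC x)).
- by apply: measurableT_comp => //; exact: measurable_vecC.
- by apply: measurableT_comp => //; exact: measurable_vecC.
- by move=> x _; rewrite lee_fin; case/andP: (fg (vecC x)).
Qed.

Lemma eintC_density : (0 < eintC (EFin \o rho) < +oo)%E.
Proof.
apply/andP; split.
  rewrite lt_def; apply/andP; split; last first.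
    by apply: integral_ge0 => x _; rewrite lee_fin density_ge0.
  apply/eqP => I0.
  have := eintC_eq0 continuous_density density_ge0 I0 0.
  by move/eqP; rewrite gt_eqF// density_gt0.
apply: le_lt_trans eintC_moment_lty; apply: (eintC_le continuous_density).
  exact: continuous_moment.
move=> z; rewrite density_ge0 /= ler_peMl ?density_ge0// lerDl.
exact: sqnormC_ge0.
Qed.

End Weight.

(** * Unitary invariance of the integral *)

Section UnitaryInvariance.
Variables (R : realType) (n : nat).
Local Notation V := 'cV[R[i]]_n.
Implicit Types (A B : 'M[R[i]]_n) (w z : V).

Lemma dotCE w z : dotC w z = (z ^t* *m w) 0 0.
Proof. by rewrite mxE; apply: eq_bigr => j _; rewrite !mxE mulrC. Qed.

Lemma trmxC_mul m p q (A : 'M[R[i]]_(m, p)) (B : 'M[R[i]]_(p, q)) :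
  (A *m B) ^t* = B ^t* *m A ^t*.
Proof. by rewrite trmx_mul map_mxM. Qed.

Lemma dotC_adj A w z : dotC (A *m w) z = dotC w (A ^t* *m z).
Proof. by rewrite !dotCE trmxC_mul trmxCK mulmxA. Qed.

Lemma sqnormC_unitary A z : A ^t* *m A = 1%:M -> sqnormC (A *m z) = sqnormC z.
Proof. by move=> AA; rewrite /sqnormC dotC_adj mulmxA AA mul1mx. Qed.

Lemma continuous_mulmx A : continuous (fun z : V => A *m z).
Proof.
move=> z; apply: (cvg_mx (F := nbhs z)) => i j.
have c : continuous (fun z : V => \sum_k A i k * z k j).
  apply: continuous_sum => k y.
  exact: (cvgM (cvg_cst (A i k) (F := nbhs y)) (@coord_continuous R[i] n 1 k j y)).
have := c z; rewrite /continuous_at [X in _ --> X](_ : _ = (A *m z) i j) ?mxE//.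
by rewrite (_ : (fun z : V => (A *m z) i j) = fun z => \sum_k A i k * z k j) //;
  apply/funext => y; rewrite mxE.
Qed.

Variable psi : R -> R.
Hypothesis hpsi : is_weight n psi.

Lemma density_unitary A z : A ^t* *m A = 1%:M ->
  density psi (A *m z) = density psi z.
Proof. by move=> AA; rewrite /density sqnormC_unitary. Qed.

(** The density is the reference function: it is radial, hence even and invariant under A, and has a
    finite positive integral. A signed h is treated through its positive and negative parts. *)
Lemma eintC_unitary A (h : V -> R) : A ^t* *m A = 1%:M -> continuous h ->
  eintC (fun z => (h (A *m z))%:E) = eintC (EFin \o h).
Proof.
move=> AA ch.
have AA' : A *m A ^t* = 1%:M by exact: mulmx1C.
have pos (f : V -> R) : continuous f -> (forall z, 0 <= f z) ->
    eintC (fun z => (f (A *m z))%:E) = eintC (EFin \o f).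
  move=> cf f0; apply: (@eintC_invariant R n (mulmx A) _ _ _ f (density psi)) => //.
  - exact: continuous_mulmx.
  - by move=> x y; rewrite mulmxDr.
  - by move=> a; exists (A ^t* *m a); rewrite mulmxA AA' mul1mx.
  - exact: continuous_density hpsi.
  - by move=> z; exact: density_ge0.
  - by move=> z; exact: density_unitary.
  - move=> z; rewrite /density /sqnormC; congr (expR (- psi (complex.Re _))).
    by apply: eq_bigr => j _; rewrite !mxE rmorphN mulrNN.
  - exact: eintC_density hpsi.
have cmax (f : V -> R) : continuous f -> continuous (fun z => Num.max (f z) 0).
  by move=> cf z; exact: (continuous_max (cf z) (cvg_cst (0 : R) (F := nbhs z))).
rewrite !eintCE [LHS]integralE [RHS]integralE.
have chN : continuous (fun z => - h z) by move=> z; exact: (cvgN (ch z)).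
have := pos _ (cmax _ ch); have := pos _ (cmax _ chN).
rewrite !eintCE => p1 p2; congr (_ - _)%E.
  transitivity (\int[@vol R n]_x (Num.max (h (A *m vecC x)) 0)%:E)%E.
    by apply: eq_integral => x _; rewrite funeposE /= EFin_max.
  rewrite p2; last by move=> z; rewrite le_max lexx orbT.
  by apply: eq_integral => x _; rewrite funeposE /= EFin_max.
transitivity (\int[@vol R n]_x (Num.max (- h (A *m vecC x)) 0)%:E)%E.
  by apply: eq_integral => x _; rewrite funenegE /= EFin_max.
rewrite p1; last by move=> z; rewrite le_max lexx orbT.
by apply: eq_integral => x _; rewrite funenegE /= EFin_max.
Qed.

End UnitaryInvariance.

(** * Membership in the Fock space *)

Section Fock.
Variables (R : realType) (n : nat) (psi : R -> R).
Hypothesis hpsi : is_weight n psi.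
Local Notation V := 'cV[R[i]]_n.
Implicit Types (f g : V -> R[i]) (A : 'M[R[i]]_n) (a c : R[i]).
Local Notation rho := (@density R n psi).
Let crho := continuous_density hpsi.

Lemma holomorphic_continuous f : holomorphic f -> continuous f.
Proof. by move=> hf z; exact: (differentiable_continuous (hf z)). Qed.

Lemma holomorphic_cst a : holomorphic (fun _ : V => a).
Proof. by move=> z; exact: differentiable_cst. Qed.

Lemma holomorphic_coord j : holomorphic (fun z : V => z j 0).
Proof. by move=> z; exact: differentiable_coord. Qed.

Lemma holomorphic_lin a f g : holomorphic f -> holomorphic g ->
  holomorphic (fun z => a * f z + g z).
Proof. by move=> hf hg z; exact: (differentiableD (differentiableZ a (hf z)) (hg z)). Qed.

Lemma continuous_cabs : continuous (@cabs R).
Proof.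
move=> z; apply/(cvgrPdist_lt (F := nbhs z)) => e e0.
apply: (near_cabs e0) => v; apply: le_lt_trans; rewrite distrC.
rewrite ler_norml lerBlDr lerBrDr addrC; apply/andP; split.
  have -> : cabs (v - z) = cabs (z - v).
    by apply: complexI; rewrite -!cabsE distrC.
  by rewrite lerBlDl; have := cabsD (z - v) v; rewrite subrK.
by have := cabsD (v - z) z; rewrite subrK.
Qed.

Definition fock_mass g (z : V) : R := cabs (g z) ^+ 2 * rho z.

Lemma fock_mass_ge0 g z : 0 <= fock_mass g z.
Proof. by rewrite mulr_ge0 ?sqr_ge0 ?density_ge0. Qed.

Lemma continuous_fock_mass g : continuous g -> continuous (fock_mass g).
Proof.
move=> cg; have c1 := comp_continuous cg continuous_cabs.
by move=> z; exact: (cvgM (cvgM (c1 z) (c1 z)) (@crho z)).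
Qed.

Lemma in_fock_lin a f g : in_fock psi f -> in_fock psi g ->
  in_fock psi (fun z => a * f z + g z).
Proof.
move=> [hf If] [hg Ig]; split; first exact: holomorphic_lin.
have cf := continuous_fock_mass (holomorphic_continuous hf).
have cg := continuous_fock_mass (holomorphic_continuous hg).
have ch := continuous_fock_mass (holomorphic_continuous (holomorphic_lin a hf hg)).
change (eintC (EFin \o fock_mass (fun z => (a * f z + g z)%R)) < +oo)%E.
pose k := 2 * cabs a ^+ 2; have k0 : 0 <= k by rewrite mulr_ge0 ?sqr_ge0.
apply: (@le_lt_trans _ _ (k%:E * eintC (EFin \o fock_mass f) +
    2%:E * eintC (EFin \o fock_mass g))%E); last first.
  by rewrite lte_add_pinfty// lte_mul_pinfty ?lee_fin.
have mf : measurable_fun setT (EFin \o (fock_mass f \o @vecC R n)).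
  by apply: measurableT_comp => //; exact: measurable_vecC.
have mg : measurable_fun setT (EFin \o (fock_mass g \o @vecC R n)).
  by apply: measurableT_comp => //; exact: measurable_vecC.
have mh : measurable_fun setT
    (EFin \o (fock_mass (fun z => a * f z + g z) \o @vecC R n)).
  by apply: measurableT_comp => //; exact: measurable_vecC.
rewrite !eintCE -!ge0_integralZl//; last 2 first.
- by move=> x _; rewrite lee_fin fock_mass_ge0.
- by move=> x _; rewrite lee_fin fock_mass_ge0.
rewrite -ge0_integralD//; last 4 first.
- by move=> x _; rewrite mule_ge0 ?lee_fin ?fock_mass_ge0.
- exact: measurable_funeM.
- by move=> x _; rewrite mule_ge0 ?lee_fin ?fock_mass_ge0.
- exact: measurable_funeM.
apply: ge0_le_integral => //.
- by move=> x _; rewrite lee_fin fock_mass_ge0.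
- by apply: emeasurable_funD; exact: measurable_funeM.
move=> x _; rewrite -!EFinM -EFinD lee_fin /fock_mass.
rewrite !mulrA -mulrDl ler_wpM2r ?density_ge0//.
have h1 := cabsD (a * f (vecC x)) (g (vecC x)); rewrite cabsM in h1.
apply: le_trans (_ : (cabs a * cabs (f (vecC x)) + cabs (g (vecC x))) ^+ 2 <= _).
  by rewrite ler_pXn2r// ?nnegrE ?addr_ge0 ?mulr_ge0 ?cabs_ge0.
rewrite /k; move: (cabs a) (cabs (f _)) (cabs (g _)) => p u v.
rewrite -subr_ge0 (_ : _ - _ = (p * u - v) ^+ 2) ?sqr_ge0//.
by ring.
Qed.

Lemma in_fock_cst a : in_fock psi (fun _ : V => a).
Proof.
split; first exact: holomorphic_cst.
have ca : 0 <= cabs a ^+ 2 by exact: sqr_ge0.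
have /andP[_ Ioo] := eintC_density hpsi.
have mr : measurable_fun setT (EFin \o (rho \o @vecC R n)).
  by apply: measurableT_comp => //; exact: measurable_vecC.
apply: (@le_lt_trans _ _ ((cabs a ^+ 2)%:E * eintC (EFin \o rho))%E).
  rewrite !eintCE -ge0_integralZl//.
  by move=> x _; rewrite lee_fin density_ge0.
by rewrite lte_mul_pinfty ?lee_fin.
Qed.

Lemma in_fock_coord j : in_fock psi (fun z : V => z j 0).
Proof.
have hj := @holomorphic_coord j.
split=> //; apply: le_lt_trans (eintC_moment_lty hpsi).
apply: (eintC_le (continuous_fock_mass (holomorphic_continuous hj)))
  => [|z]; first exact: continuous_moment hpsi.
rewrite fock_mass_ge0 /= ler_wpM2r ?density_ge0// sqnormCE (bigD1 j)//= cabs_sqr.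
rewrite addrCA lerDl addr_ge0// sumr_ge0// => k _.
by rewrite addr_ge0 ?sqr_ge0.
Qed.

(** From uv <= u^2 + v^2, the mass of f o A being that of f. The bound does not depend on A, which
    is what Fubini over the circle requires. *)
Lemma fock_cross_le A f g : A ^t* *m A = 1%:M -> continuous f -> continuous g ->
  (eintC (fun z => (cabs (f (A *m z)) * cabs (g z) * rho z)%:E) <=
   eintC (EFin \o fock_mass f) + eintC (EFin \o fock_mass g))%E.
Proof.
move=> AA cf cg.
have cfA := comp_continuous (@continuous_mulmx R n A) cf.
have c1 := comp_continuous cfA continuous_cabs.
have c2 := comp_continuous cg continuous_cabs.
have ch : continuous (fun z => cabs (f (A *m z)) * cabs (g z) * rho z).
  by move=> z; exact: (cvgM (cvgM (c1 z) (c2 z)) (@crho z)).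
rewrite -(eintC_unitary hpsi AA (continuous_fock_mass cf)).
have cfA' : continuous (fun z => fock_mass f (A *m z)).
  exact: (comp_continuous (@continuous_mulmx R n A) (continuous_fock_mass cf)).
have mf : measurable_fun setT (EFin \o ((fun z => fock_mass f (A *m z)) \o @vecC R n)).
  by apply: measurableT_comp => //; exact: measurable_vecC.
have mg : measurable_fun setT (EFin \o (fock_mass g \o @vecC R n)).
  by apply: measurableT_comp => //; exact/measurable_vecC/continuous_fock_mass.
have mh : measurable_fun setT
    (EFin \o ((fun z => cabs (f (A *m z)) * cabs (g z) * rho z) \o @vecC R n)).
  by apply: measurableT_comp => //; exact: measurable_vecC.
rewrite !eintCE -ge0_integralD//; last 2 first.
- by move=> x _; rewrite lee_fin fock_mass_ge0.
- by move=> x _; rewrite lee_fin fock_mass_ge0.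
apply: ge0_le_integral => //.
- by move=> x _; rewrite lee_fin !mulr_ge0 ?cabs_ge0 ?density_ge0.
- exact: emeasurable_funD.
move=> x _; rewrite -EFinD lee_fin /fock_mass (density_unitary psi _ AA) -mulrDl.
rewrite ler_wpM2r ?density_ge0//.
have := cabs_ge0 (f (A *m vecC x)); have := cabs_ge0 (g (vecC x)).
move: (cabs _) (cabs _) => u v u0 v0.
by have := sqr_ge0 (u - v); have := mulr_ge0 u0 v0; rewrite sqrrB mulr2n; nra.
Qed.

End Fock.

(** * Unitary interpolation of a self-adjoint contraction *)

Section MoebiusFamily.
Variable R : realType.
Implicit Types (d : R) (w : R[i]).

(* For a real contraction d this maps the unit circle into itself and 0 to d;
   the case |d| = 1, where the usual formula has a removable singularity on
   the circle, is treated apart. *)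
Definition moebius d w : R[i] :=
  if `|d| == 1 then d%:C else (w + d%:C) / (1 + w * d%:C).

Lemma moebius0 d : moebius d 0 = d%:C.
Proof. by rewrite /moebius; case: ifP => // _; rewrite mul0r addr0 divr1 add0r. Qed.

Lemma conjC_real d : (d%:C)^* = d%:C :> R[i].
Proof. by rewrite conj_Creal// complex_real. Qed.

Lemma moebius_conj d w : (moebius d w)^* = moebius d w^*.
Proof.
rewrite /moebius; case: ifP => _; first exact: conjC_real.
set r := d%:C; have rr : r^* = r := conjC_real d.
by rewrite fmorph_div !rmorphD rmorphM rmorph1 /= rr.
Qed.

Lemma moebius_den d w : `|d| <= 1 -> `|d| != 1 -> cabs w <= 1 ->
  1 + w * d%:C != 0.
Proof.
move=> d1 d1' w1; apply/eqP => /eqP; rewrite addrC addr_eq0 => /eqP H.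
have : cabs (w * d%:C) = 1.
  by rewrite H; apply: complexI; rewrite -cabsE normrN normr1.
rewrite cabsM cabs_real => H1; have : cabs w * `|d| < 1.
  apply: le_lt_trans (_ : `|d| < 1); first by rewrite ler_piMl.
  by rewrite lt_neqAle d1' d1.
by rewrite H1 ltxx.
Qed.

(** For |w| = 1 and |d| < 1 the numerator w + d is w times the conjugate of the denominator. *)
Lemma moebius_unimodular d w : `|d| <= 1 -> cabs w = 1 ->
  (moebius d w)^* * moebius d w = 1.
Proof.
move=> d1 w1; have ww : w * w^* = 1.
  by rewrite -normCK cabsE w1 expr1n.
rewrite /moebius; case: ifPn => [/eqP d1'|d1'].
  rewrite conjC_real -rmorphM /= -expr2 -[d ^+ 2]real_normK ?num_real//.
  by rewrite d1' expr1n.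
have w1' : cabs w <= 1 by rewrite w1.
have := moebius_den d1 d1' w1'.
set r := d%:C => den; have rr : r^* = r := conjC_real d.
have den' : 1 + w^* * r != 0.
  by rewrite -rr -rmorphM -[1](rmorph1 (@Num.conj R[i])) -rmorphD conjC_eq0.
rewrite fmorph_div !rmorphD rmorphM rmorph1 /= rr mulf_div.
have -> : (w^* + r) * (w + r) = (1 + w^* * r) * (1 + w * r).
  transitivity (w * w^* + r * (w + w^*) + r ^+ 2); first by ring.
  transitivity (1 + r * (w + w^*) + (w * w^*) * r ^+ 2); last by ring.
  by rewrite ww mul1r.
by rewrite divff// mulf_neq0.
Qed.

Lemma differentiable_moebius d w : `|d| <= 1 -> cabs w <= 1 ->
  differentiable (moebius d) w.
Proof.
move=> d1 w1; case: (boolP (`|d| == 1)) => d1'.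
  rewrite (_ : moebius d = cst d%:C); first exact: differentiable_cst.
  by apply/funext => v; rewrite /moebius d1'.
rewrite (_ : moebius d = fun w => (w + d%:C) / (1 + w * d%:C)); last first.
  by apply/funext => v; rewrite /moebius (negbTE d1').
have h0 : differentiable (@id R[i]) w by exact/derivable1_diffP/derivable_id.
have h1 : differentiable (fun w : R[i] => w + d%:C) w.
  by apply: differentiableD; [exact: h0|exact: differentiable_cst].
have h2 : differentiable (fun w : R[i] => 1 + w * d%:C) w.
  apply: differentiableD; first exact: differentiable_cst.
  by apply: differentiableM; [exact: h0|exact: differentiable_cst].
exact: (differentiableM h1 (differentiableV h2 (moebius_den d1 d1' w1))).
Qed.

Lemma derivable_cdiff_at (F : R[i] -> R[i]) w : derivable F w 1 -> cdiff_at F w.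
Proof.
move=> /cvg_ex[/= a Fa]; exists a => e e0.
have e0' : 0 < e%:C :> R[i] by rewrite ltcR.
move/cvgrPdist_lt: Fa => /(_ _ e0'); rewrite near_withinE => /nbhs_ballP[[d ?]].
rewrite /= ltcE /= => /andP[/eqP -> d0] hd; exists d => // v vd.
have [->|vw] := eqVneq v w; first by rewrite !subrr mulr0 subr0 cabs0 mulr0.
have vw0 : v - w != 0 by rewrite subr_eq0.
have /hd : ball 0 (d%:C) (v - w).
  by rewrite /ball /= sub0r normrN cabsE ltcR.
move=> /(_ vw0); rewrite [_ *: 1]mulr1 subrK => H.
have -> : F v - F w - a * (v - w) = - ((a - (v - w)^-1 * (F v - F w)) * (v - w)).
  by rewrite mulrBl [_^-1 * _ * _]mulrAC mulVf// mul1r; ring.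
have -> (x : R[i]) : cabs (- x) = cabs x.
  by apply: complexI; rewrite -!cabsE normrN.
rewrite cabsM ler_wpM2r ?cabs_ge0//.
by move: H; rewrite cabsE ltcR => /ltW.
Qed.

End MoebiusFamily.

(** * Diagonalization and the unitary family *)

Section UnitaryFamily.
Variables (R : realType) (n : nat).
Local Notation V := 'cV[R[i]]_n.
Implicit Types (C P : 'M[R[i]]_n).

(** A combination of fixed vectors with the diagonal entries as coefficients: differentiability of
    W(w) z reduces to that of each scalar [moebius] map. *)
Lemma mul_diag_mxE (A B : 'M[R[i]]_n) (d : 'rV[R[i]]_n) (z : V) :
  (A *m diag_mx d *m B) *m z = \sum_j d 0 j *: ((B *m z) j 0 *: col j A).
Proof.
apply/matrixP => i k; rewrite ord1 -mulmxA summxE mxE; apply: eq_bigr => j _.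
by rewrite mul_mx_diag !mxE mulrC mulrCA; ring.
Qed.

Lemma sqnormC_delta j : sqnormC (delta_mx j 0 : V) = 1.
Proof.
rewrite sqnormCE (bigD1 j)//= big1 ?addr0 => [|k kj].
  by rewrite mxE !eqxx /=; ring.
by rewrite mxE (negbTE kj) /=; ring.
Qed.

(** Column j of P^* is a unit eigenvector for d_j, on which the norm of C is tested. *)
Lemma opnorm_eigenvalue C P (d : 'rV[R]_n) : P *m P ^t* = 1%:M ->
  C = P ^t* *m diag_mx (map_mx (fun x => x%:C) d) *m P ->
  opnorm C <= 1 -> forall j, `|d 0 j| <= 1.
Proof.
move=> PP CE C1 j; pose D := diag_mx (map_mx (fun x => x%:C : R[i]) d).
have PP' : (P ^t*) ^t* *m P ^t* = 1%:M by rewrite trmxCK.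
have P'P : P ^t* *m P = 1%:M by exact: mulmx1C.
have normCE z : sqnormC (C *m z) =
    \sum_k d 0 k ^+ 2 * cabs ((P *m z) k 0) ^+ 2.
  rewrite CE -!mulmxA (sqnormC_unitary _ PP') sqnormCE; apply: eq_bigr => k _.
  rewrite -cabs_sqr mul_diag_mx !mxE cabsM cabs_real exprMn real_normK//.
  exact: num_real.
(* The supremum of an unbounded set is a default value, so [opnorm C <= 1] yields a pointwise bound
   only once boundedness is known. *)
have ub : has_ubound [set normC (C *m z) | z in [set z : V | normC z <= 1]].
  exists (Num.sqrt (\sum_k d 0 k ^+ 2)) => _ [z /= z1 <-]; rewrite /normC normCE.
  rewrite ler_wsqrtr// ler_sum// => k _; rewrite ler_piMr ?sqr_ge0//.
  apply: (@le_trans _ _ (sqnormC (P *m z))).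
    rewrite sqnormCE (bigD1 k)//= -cabs_sqr lerDl sumr_ge0// => l _.
    by rewrite addr_ge0 ?sqr_ge0.
  rewrite (sqnormC_unitary _ P'P).
  move: z1; rewrite /normC -{1}sqrtr1 ler_psqrt ?nnegrE ?sqnormC_ge0 ?ler01//.
apply: le_trans C1; have := ub_le_sup ub; apply.
exists (P ^t* *m delta_mx j 0).
  by rewrite /normC /= (sqnormC_unitary _ PP') sqnormC_delta sqrtr1.
rewrite /normC normCE mulmxA PP mul1mx (bigD1 j)//= big1 ?addr0 => [|k kj].
  by rewrite mxE !eqxx /= cabs_real normr1 expr1n mulr1 sqrtr_sqr.
by rewrite mxE (negbTE kj) /= cabs0 expr0n mulr0.
Qed.

Lemma selfadjoint_diagonalization C : selfadjoint_mx C ->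
  exists P (d : 'rV[R]_n), P *m P ^t* = 1%:M /\
    C = P ^t* *m diag_mx (map_mx (fun x => x%:C) d) *m P.
Proof.
move=> CC; have hC : C \is hermsymmx.
  by apply/is_hermitianmxP; rewrite expr0 scale1r.
have /orthomx_spectralP E := hermitian_normalmx hC.
have uP := spectral_unitarymx C; rewrite (invmx_unitary uP) in E.
exists (spectralmx C), (map_mx (@complex.Re R) (spectral_diag C)); split.
  exact/unitarymxP.
rewrite [LHS]E; have -> //: map_mx (fun x => x%:C)
  (map_mx (@complex.Re R) (spectral_diag C)) = spectral_diag C.
apply/matrixP => i j; rewrite !mxE.
have /mxOverP /(_ i j) := hermitian_spectral_diag_real hC.
by move=> /complex_realP[x ->].
Qed.

Lemma unitary_interpolation C : selfadjoint_mx C -> opnorm C <= 1 ->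
  exists W : R[i] -> 'M[R[i]]_n, [/\ W 0 = C,
    forall w, cabs w = 1 -> (W w) ^t* *m W w = 1%:M,
    forall w, (W w) ^t* = W w^* &
    forall z w, cabs w <= 1 -> differentiable (fun w => W w *m z : V) w].
Proof.
move=> CC C1; have [P [d [PP CE]]] := selfadjoint_diagonalization CC.
have d1 := opnorm_eigenvalue PP CE C1.
pose D w := \row_j moebius (d 0 j) w.
exists (fun w => P ^t* *m diag_mx (D w) *m P).
have WC w : (P ^t* *m diag_mx (D w) *m P) ^t* = P ^t* *m diag_mx (D w^*) *m P.
  rewrite !trmxC_mul trmxCK mulmxA; congr (_ *m _ *m _).
  rewrite tr_diag_mx map_diag_mx; congr diag_mx; apply/matrixP => i j.
  by rewrite !mxE; exact: moebius_conj.
split=> //.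
- rewrite CE; have -> //: D 0 = map_mx (fun x => x%:C) d.
  by apply/matrixP => i j; rewrite !mxE moebius0 ord1.
- move=> w w1; rewrite WC !mulmxA -(mulmxA _ P) PP mulmx1.
  rewrite -[_ *m diag_mx _ *m diag_mx _]mulmxA mulmx_diag (_ : \row_j _ = const_mx 1).
    by rewrite diag_const_mx mulmx1; exact: mulmx1C.
  apply/matrixP => i j; rewrite !mxE -moebius_conj.
  exact: moebius_unimodular.
- move=> z w w1; under eq_fun do rewrite mul_diag_mxE.
  rewrite (_ : (fun _ => _) = \sum_(j < n) fun w =>
    D w 0 j *: ((P *m z) j 0 *: col j (P ^t*))); last first.
    by apply/funext => v; rewrite fct_sumE.
  apply: differentiable_sum => j; apply: differentiableZl.
  rewrite (_ : (fun _ => _) = moebius (d 0 j)).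
    exact: differentiable_moebius.
  by apply/funext => v; rewrite mxE.
Qed.

End UnitaryFamily.

(** * Symmetry of the composition operator *)

Section StripFubini.
Variables (R : realType) (n : nat).
Local Notation V := 'cV[R[i]]_n.
Local Notation X := (ms_carrier (Cn_space R n)).
Variables (h : R * V -> R) (a b : R) (K : \bar R).
Hypotheses (ch : continuous h) (Koo : (K < +oo)%E).
Hypothesis hK : forall t, (eintC (fun z => (`|h (t, z)|)%:E) <= K)%E.
Local Open Scope ereal_scope.

Lemma measurable_strip :
  measurable_fun setT (fun p : measurableTypeR R * X => h (p.1, vecC p.2)).
Proof.
apply: (@approximable_measurable _ _ _ _
  (fun p : measurableTypeR R * X => ((p.1 : R), vecC p.2)) h) => //.
apply: approximable_pair.
  by apply: (@approximable_precomp _ _ _ _ _ (@idfun R) fst) => //; exact: approximable_id.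
by apply: (@approximable_precomp _ _ _ _ _ _ snd) => //; exact: approximable_vecC.
Qed.

(** After cutting off by the indicator of [a, b], the absolute integral is at most K times the
    length of the interval, so Fubini applies to the full product measure. *)
Lemma strip_Fubini :
  \int[@vol R n]_x \int[@lebesgue_measure R]_(t in `[a, b]) (h (t, vecC x))%:E =
  \int[@lebesgue_measure R]_(t in `[a, b]) \int[@vol R n]_x (h (t, vecC x))%:E.
Proof.
pose D : set (measurableTypeR R) := `[a, b]%classic.
have mD : measurable D by exact: measurable_itv.
pose k (p : measurableTypeR R * X) : \bar R := (h (p.1, vecC p.2) * \1_D p.1)%:E.
have mh := measurable_strip.
have mi : measurable_fun setT (fun p : measurableTypeR R * X => \1_D p.1 : R).
  exact: (measurableT_comp (measurable_indic mD)).
have mk : measurable_fun setT k.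
  by apply: measurableT_comp => //; exact: measurable_funM.
have kE (t : measurableTypeR R) (x : X) :
    k (t, x) = ((fun t => (h (t, vecC x))%:E) \_ D) t.
  rewrite /k /patch indicE /=; case: (t \in D) => /=; first by rewrite mulr1.
  by rewrite mulr0.
have K0 : 0 <= K by apply: le_trans (hK 0); apply: integral_ge0 => x _; rewrite lee_fin.
have ik : (@lebesgue_measure R \x @vol R n).-integrable setT k.
  apply/(integrable12ltyP (@lebesgue_measure R) (@vol R n) mk).
  apply: (@le_lt_trans _ _ (\int[@lebesgue_measure R]_t (K * (\1_D t)%:E))).
    apply: ge0_le_integral => //.
    - by move=> t _; exact: integral_ge0.
    - apply: (measurable_fun_fubini_tonelli_F (m2 := @vol R n) (fun p => `|k p|)) => //.
      exact: measurableT_comp.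
    - by apply: measurable_funeM; apply: measurableT_comp.
    - move=> t _; have [tD|tD] := boolP (t \in D).
        rewrite indicE tD mule1; apply: le_trans (hK t).
        rewrite le_eqVlt; apply/orP; left; apply/eqP.
        by apply: eq_integral => x _; rewrite kE /patch tD.
      rewrite indicE (negbTE tD) mule0 integral0_eq// => x _.
      by rewrite kE /patch (negbTE tD) abse0.
  rewrite ge0_integralZl//; last by apply: measurableT_comp.
  rewrite integral_indic// setIT lte_mul_pinfty ?ge0_fin_numE//.
  have H : @lebesgue_measure R `[a, b]%classic < +oo.
    by rewrite lebesgue_measure_itv /=; case: ifP => _; rewrite -?EFinD ltry.
  exact: H.
have := Fubini ik.
rewrite [X in X = _ -> _](_ : _ = \int[@lebesgue_measure R]_(t in D)
  \int[@vol R n]_x (h (t, vecC x))%:E); last first.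
  rewrite [RHS]integral_mkcond; apply: eq_integral => t _; rewrite /patch.
  have [tD|tD] := boolP (t \in D).
    by apply: eq_integral => x _; rewrite kE /patch tD.
  by rewrite integral0_eq// => x _; rewrite kE /patch (negbTE tD).
move=> ->; apply: eq_integral => x _; rewrite [LHS]integral_mkcond.
by apply: eq_integral => t _; rewrite kE.
Qed.

End StripFubini.

Lemma Re_mul_real (R : realType) (z : R[i]) (r : R) :
  complex.Re (z * r%:C) = complex.Re z * r.
Proof. by case: z => a b /=; rewrite mulr0 subr0. Qed.

Section SelfadjointContraction.
Variables (R : realType) (n : nat) (psi : R -> R).
Hypothesis hpsi : is_weight n psi.
Local Notation V := 'cV[R[i]]_n.
Local Notation rho := (@density R n psi).
Implicit Types f g : V -> R[i].

Variables (C : 'M[R[i]]_n) (W : R[i] -> 'M[R[i]]_n).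
Hypothesis W0 : W 0 = C.
Hypothesis W_unitary : forall w, cabs w = 1 -> (W w) ^t* *m W w = 1%:M.
Hypothesis W_adj : forall w, (W w) ^t* = W w^*.
Hypothesis W_diff : forall z w, cabs w <= 1 ->
  differentiable (fun w => W w *m z : V) w.

Definition cis (t : R) : R[i] := cos t +i* sin t.

Lemma cabs_cis t : cabs (cis t) = 1.
Proof. by rewrite /cabs normc_def /= cos2Dsin2 sqrtr1. Qed.

Lemma conj_cis t : (cis t)^* = cis (- t).
Proof. by rewrite /cis cosN sinN. Qed.

Lemma continuous_cis : continuous cis.
Proof.
move=> t; apply: (cvg_complex (F := nbhs t)); first exact: continuous_cos.
exact: continuous_sin.
Qed.

Let pi2 : 0 < 2 * pi :> R. Proof. by rewrite mulr_gt0// pi_gt0. Qed.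

(** For fixed z only the argument of f depends on w, so the expression is the real part of a
    function holomorphic in w. The factor 1 / (2 pi) normalizes the mean over the circle. *)
Let H f g (p : R * V) : R :=
  complex.Re (f (W (cis p.1) *m p.2) * ((g p.2)^* * (rho p.2 / (2 * pi))%:C)).

Let cW i k : continuous (fun t => W (cis t) i k).
Proof.
move=> t; have d : differentiable (fun w => W w *m delta_mx k 0 : V) (cis t).
  by apply: W_diff; rewrite cabs_cis.
have c1 : {for t, continuous (fun t => W (cis t) *m delta_mx k 0 : V)}.
  exact: (continuous_comp (@continuous_cis t) (differentiable_continuous d)).
have := continuous_comp c1 (@coord_continuous R[i] n 1 i 0 _).
rewrite (_ : _ \o _ = fun t => W (cis t) i k)//.
by apply/funext => s /=; rewrite -colE mxE.
Qed.

Let cWz : continuous (fun p : R * V => W (cis p.1) *m p.2).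
Proof.
move=> p; apply: (cvg_mx (F := nbhs p)) => i j.
have c : continuous (fun p : R * V => \sum_k W (cis p.1) i k * p.2 k j).
  apply: continuous_sum => k q.
  have c1 : {for q, continuous (fun q : R * V => W (cis q.1) i k)}.
    exact: (continuous_comp (cvg_fst : fst @ q --> q.1) (@cW i k q.1)).
  have c2 : {for q, continuous (fun q : R * V => q.2 k j)}.
    exact: (continuous_comp (cvg_snd : snd @ q --> q.2) (@coord_continuous R[i] n 1 k j q.2)).
  exact: (cvgM c1 c2).
have := c p; rewrite /continuous_at.
rewrite [X in _ --> X](_ : _ = (W (cis p.1) *m p.2) i j) ?mxE//.
by rewrite (_ : (fun p : R * V => (W (cis p.1) *m p.2) i j) =
  fun p => \sum_k W (cis p.1) i k * p.2 k j)//; apply/funext => y; rewrite mxE.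
Qed.

Let cH f g : holomorphic f -> holomorphic g -> continuous (H f g).
Proof.
move=> /holomorphic_continuous cf /holomorphic_continuous cg.
have c1 := comp_continuous cWz cf.
have c2 : continuous (fun p : R * V => (g p.2)^*).
  move=> p; exact: (continuous_comp (continuous_comp (cvg_snd : snd @ p --> p.2)
    (cg p.2)) (@continuous_conjC R _)).
have c3 : continuous (fun p : R * V => (rho p.2 / (2 * pi))%:C : R[i]).
  move=> p; apply: (cvg_complex (F := nbhs p)); last exact: cvg_cst.
  have c4 : {for p, continuous (fun p : R * V => rho p.2)}.
    exact: (continuous_comp (cvg_snd : snd @ p --> p.2) (@continuous_density _ _ _ hpsi p.2)).
  exact: (cvgM c4 (cvg_cst _ (F := nbhs p))).
have c4 : continuous (fun p : R * V => f (W (cis p.1) *m p.2) *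
    ((g p.2)^* * (rho p.2 / (2 * pi))%:C)).
  by move=> p; exact: (cvgM (c1 p) (cvgM (c2 p) (c3 p))).
exact: (comp_continuous c4 (@continuous_ReC R)).
Qed.

Let H_mean f g z : holomorphic f ->
  (\int[@lebesgue_measure R]_(t in `[(- pi)%R, pi]) (H f g (t, z))%:E)%E =
  (complex.Re (f (C *m z) * (g z)^* * (rho z)%:C))%:E.
Proof.
move=> hf; pose k := (g z)^* * (rho z / (2 * pi))%:C.
have Fd w : cabs w <= 1 -> cdiff_at (fun w => f (W w *m z) * k) w.
  move=> w1; apply/derivable_cdiff_at/derivable1_diffP.
  have d := differentiable_comp (W_diff z w1) (hf _).
  exact: (differentiableM d (differentiable_cst k w)).
have := mean_value Fd; rewrite W0 => ->; congr EFin.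
rewrite /k mulrA !Re_mul_real mulrC -mulrA divfK// gt_eqF//.
Qed.

Let H_bound f g t z :
  `|H f g (t, z)| <= cabs (f (W (cis t) *m z)) * cabs (g z) * rho z.
Proof.
apply: le_trans (abs_Re_le _) _; rewrite -/(cabs _) !cabsM cabs_conj cabs_real mulrA.
apply: ler_wpM2l; first by rewrite mulr_ge0 ?cabs_ge0.
rewrite ger0_norm ?divr_ge0 ?density_ge0 ?(ltW pi2)//.
rewrite ler_pdivrMr// ler_peMr ?density_ge0//.
by have := pi_ge2 R; lra.
Qed.

Let cHt f g t : holomorphic f -> holomorphic g ->
  continuous (fun z : V => H f g (t, z)).
Proof.
move=> hf hg z; have c0 : {for z, continuous (fun z : V => (t, z))}.
  exact: (cvg_pair (cvg_cst t (F := nbhs z)) cvg_id).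
exact: (continuous_comp c0 (@cH f g hf hg (t, z))).
Qed.

Let H_int_bound f g : in_fock psi f -> in_fock psi g -> forall t,
  (eintC (fun z => (`|H f g (t, z)|)%:E) <=
   eintC (EFin \o fock_mass psi f) + eintC (EFin \o fock_mass psi g))%E.
Proof.
move=> [hf _] [hg _] t.
have cf := holomorphic_continuous hf; have cg := holomorphic_continuous hg.
have u := W_unitary (cabs_cis t).
apply: le_trans (fock_cross_le hpsi u cf cg).
have c1 : continuous (fun z => `|H f g (t, z)|).
  by move=> z; exact: (cvg_norm (@cHt f g t hf hg z)).
have c2 : continuous (fun z => cabs (f (W (cis t) *m z)) * cabs (g z) * rho z).
  have c3 := comp_continuous (comp_continuous (@continuous_mulmx R n (W (cis t))) cf)
    (@continuous_cabs R).
  have c4 := comp_continuous cg (@continuous_cabs R).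
  by move=> z; exact: (cvgM (cvgM (c3 z) (c4 z)) (@continuous_density _ _ _ hpsi z)).
by apply: (eintC_le c1 c2) => z; rewrite normr_ge0 H_bound.
Qed.

(** W(exp(i t)) is the adjoint, hence the inverse, of W(exp(- i t)), so the substitution frees f and
    loads g; a real part is unchanged by the conjugation that then exchanges f and g. *)
Let H_adj f g t z : H f g (t, W (cis (- t)) *m z) = H g f (- t, z).
Proof.
have u := W_unitary (cabs_cis (- t)).
have u' : W (cis t) *m W (cis (- t)) = 1%:M.
  by rewrite -[X in W X *m _]conjCK conj_cis -W_adj.
rewrite /H /= mulmxA u' mul1mx (density_unitary psi _ u) !mulrA !Re_mul_real.
congr (_ * _); rewrite -[RHS]opprK.
set a := f z; set b := g _; case: a => a1 a2; case: b => b1 b2 /=.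
by ring.
Qed.

Lemma Re_eintC_swap f g : in_fock psi f -> in_fock psi g ->
  eintC (fun z => (complex.Re (f (C *m z) * (g z)^* * (rho z)%:C))%:E) =
  eintC (fun z => (complex.Re (g (C *m z) * (f z)^* * (rho z)%:C))%:E).
Proof.
move=> ff gf; have [hf If] := ff; have [hg Ig] := gf.
pose K := (eintC (EFin \o fock_mass psi f) + eintC (EFin \o fock_mass psi g))%E.
have Koo : (K < +oo)%E by rewrite lte_add_pinfty.
pose H' (p : R * V) := H g f (- p.1, p.2).
have cH' : continuous H'.
  move=> p; have c0 : {for p, continuous (fun p : R * V => (- p.1, p.2))}.
    exact: (cvg_pair (cvgN (cvg_fst : fst @ p --> p.1)) (cvg_snd : snd @ p --> p.2)).
  exact: (continuous_comp c0 (@cH g f hg hf (- p.1, p.2))).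
rewrite !eintCE.
transitivity (\int[@vol R n]_x \int[@lebesgue_measure R]_(t in `[(- pi)%R, pi])
    (H f g (t, vecC x))%:E)%E.
  by apply: eq_integral => x _; rewrite H_mean.
rewrite (strip_Fubini _ _ (cH hf hg) Koo); last exact: (H_int_bound ff gf).
transitivity (\int[@lebesgue_measure R]_(t in `[(- pi)%R, pi]) \int[@vol R n]_x
    (H' (t, vecC x))%:E)%E.
  apply: eq_integral => t _.
  have u := W_unitary (cabs_cis (- t)).
  rewrite -[LHS]/(eintC (EFin \o fun z => H f g (t, z))).
  rewrite -(eintC_unitary hpsi u (@cHt f g t hf hg)) eintCE.
  by apply: eq_integral => x _; rewrite H_adj.
rewrite -(strip_Fubini (K := K) _ _ cH' Koo); last first.
  by move=> t; rewrite /K addeC; exact: (H_int_bound gf ff (- t)).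
(* The reflection of [-pi, pi] turns [H'] back into [H g f], whose integral over the circle is the
   value at w = 0. *)
apply: eq_integral => x _; rewrite -(H_mean f (vecC x) hg).
have c1 : continuous (fun t => H g f (t, vecC x)).
  move=> t; have c0 : {for t, continuous (fun t : R => (t, vecC x))}.
    exact: (cvg_pair cvg_id (cvg_cst (vecC x) (F := nbhs t))).
  exact: (continuous_comp c0 (@cH g f hg hf (t, vecC x))).
have pi0 : - pi <= pi :> R by rewrite ge0_cp ?pi_ge0.
have := @integration_by_substitution_oppr R (fun t => H g f (t, vecC x)) (- pi) pi pi0
  (continuous_subspaceT c1).
by rewrite opprK => ->.
Qed.

End SelfadjointContraction.

(** * Symmetry and linearity of the inner product *)

Section FockDot.
Variables (R : realType) (n : nat) (psi : R -> R).
Hypothesis hpsi : is_weight n psi.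
Local Notation V := 'cV[R[i]]_n.
Local Notation rho := (@density R n psi).
Local Notation dot := (fock_dot psi).
Implicit Types (f g : V -> R[i]) (C : 'M[R[i]]_n).

Lemma in_fock_scale a f : in_fock psi f -> in_fock psi (fun z => a * f z).
Proof.
move=> hf; have := in_fock_lin hpsi a hf (in_fock_cst hpsi 0).
by rewrite (_ : (fun z => _ + _) = fun z => a * f z)//; apply/funext => z; rewrite addr0.
Qed.

(** The real part is the averaging identity; since Im x = Re(- i x), the imaginary part is the same
    identity for - i f. *)
Lemma dot_swap C f g : selfadjoint_mx C -> opnorm C <= 1 ->
  in_fock psi f -> in_fock psi g ->
  dot (fun z => f (C *m z)) g = dot f (fun z => g (C *m z)).
Proof.
move=> CC C1 hf hg; have [W [W0 Wu Wa Wd]] := unitary_interpolation CC C1.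
have hf1 : in_fock psi (fun z => - 'i * f z) by exact: in_fock_scale.
have E1 := Re_eintC_swap hpsi W0 Wu Wa Wd hf hg.
have E2 := Re_eintC_swap hpsi W0 Wu Wa Wd hf1 hg.
rewrite /fock_dot /intC; congr (fine _ +i* fine _).
  rewrite E1; congr eintC; apply/funext => z; congr EFin; rewrite !Re_mul_real.
  by congr (_ * _); case: (f z) (g _) => [a b] [c d] /=; ring.
transitivity (eintC (fun z : V =>
    (complex.Re (- 'i * f (C *m z) * (g z)^* * (rho z)%:C))%:E)).
  congr eintC; apply/funext => z; congr EFin.
  by case: (f _) (g z) => [a b] [c d] /=; ring.
rewrite E2; congr eintC; apply/funext => z; congr EFin.
by case: (f z) (g _) => [a b] [c d] /=; ring.
Qed.

Definition fock_integrand f g z : R[i] := f z * (g z)^* * (rho z)%:C.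

Lemma cabs_integrand f g z : cabs (fock_integrand f g z) = cabs (f z) * cabs (g z) * rho z.
Proof. by rewrite !cabsM cabs_conj cabs_real ger0_norm ?density_ge0. Qed.

Lemma continuous_integrand f g : continuous f -> continuous g ->
  continuous (fock_integrand f g).
Proof.
move=> cf cg.
have c1 := comp_continuous cg (@continuous_conjC R).
have c2 : continuous (fun z : V => (rho z)%:C : R[i]).
  move=> z; apply: (cvg_complex (F := nbhs z)); last exact: cvg_cst.
  exact: (@continuous_density _ _ _ hpsi z).
by move=> z; exact: (cvgM (cvgM (cf z) (c1 z)) (c2 z)).
Qed.

(** [P] will be the real or the imaginary part; the domination is the cross estimate for the
    identity matrix. *)
Lemma integrable_integrand (P : R[i] -> R) f g : continuous P ->
  (forall z, `|P z| <= cabs z) -> in_fock psi f -> in_fock psi g ->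
  (@vol R n).-integrable setT (EFin \o (fun x => P (fock_integrand f g (vecC x)))).
Proof.
move=> cP hP [/holomorphic_continuous cf If] [/holomorphic_continuous cg Ig].
have ci := continuous_integrand cf cg.
have cPi := comp_continuous ci cP.
have mPi := measurable_vecC cPi.
apply/integrableP; split; first exact: measurableT_comp.
apply: (@le_lt_trans _ _ (eintC (EFin \o fock_mass psi f) +
  eintC (EFin \o fock_mass psi g))%E); last by rewrite lte_add_pinfty.
have u : (1%:M : 'M[R[i]]_n) ^t* *m 1%:M = 1%:M by rewrite trmx1 map_mx1 mulmx1.
apply: le_trans (fock_cross_le hpsi u cf cg).
have c1 : continuous (fun z : V => `|P (fock_integrand f g z)|).
  by move=> z; exact: (cvg_norm (cPi z)).
have c2 : continuous (fun z : V => cabs (f (1%:M *m z)) * cabs (g z) * rho z).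
  have := comp_continuous ci (@continuous_cabs R).
  rewrite (_ : _ \o _ = fun z : V => cabs (f (1%:M *m z)) * cabs (g z) * rho z)//.
  by apply/funext => z; rewrite /= cabs_integrand mul1mx.
apply: (eintC_le c1 c2) => z.
by rewrite normr_ge0 mul1mx -cabs_integrand hP.
Qed.

Lemma integrable_Re f g : in_fock psi f -> in_fock psi g ->
  (@vol R n).-integrable setT (EFin \o (fun x => complex.Re (fock_integrand f g (vecC x)))).
Proof. by apply: integrable_integrand; [exact: continuous_ReC|exact: abs_Re_le]. Qed.

Lemma integrable_Im f g : in_fock psi f -> in_fock psi g ->
  (@vol R n).-integrable setT (EFin \o (fun x => complex.Im (fock_integrand f g (vecC x)))).
Proof. by apply: integrable_integrand; [exact: continuous_ImC|exact: abs_Im_le]. Qed.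

Lemma fock_dotE f g : dot f g =
  (\int[@vol R n]_x complex.Re (fock_integrand f g (vecC x))) +i*
  (\int[@vol R n]_x complex.Im (fock_integrand f g (vecC x))).
Proof. by []. Qed.

Lemma fock_dot_lin a f1 f2 g : in_fock psi f1 -> in_fock psi f2 -> in_fock psi g ->
  dot (fun z => a * f1 z + f2 z) g = a * dot f1 g + dot f2 g.
Proof.
move=> h1 h2 hg; rewrite !fock_dotE.
have r1 := integrable_Re h1 hg; have r2 := integrable_Re h2 hg.
have i1 := integrable_Im h1 hg; have i2 := integrable_Im h2 hg.
have lin (x y : R) (p q r : ms_carrier (Cn_space R n) -> R) :
    (@vol R n).-integrable setT (EFin \o p) -> (@vol R n).-integrable setT (EFin \o q) ->
    (@vol R n).-integrable setT (EFin \o r) ->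
    \int[@vol R n]_z (x * p z + y * q z + r z) =
    x * \int[@vol R n]_z p z + y * \int[@vol R n]_z q z + \int[@vol R n]_z r z.
  move=> ip iq ir.
  have ixp : (@vol R n).-integrable setT (EFin \o (fun z => x * p z)).
    exact: (integrableZl _ x ip).
  have iyq : (@vol R n).-integrable setT (EFin \o (fun z => y * q z)).
    exact: (integrableZl _ y iq).
  rewrite RintegralD//; last exact: (integrableD _ ixp iyq).
  by rewrite RintegralD// !RintegralZl.
case: a => x y; simpc; congr (_ +i* _).
  rewrite -mulNr -lin//; apply: eq_Rintegral => z _; rewrite /fock_integrand.
  by case: (f1 _) (f2 _) (g _) => [a b] [c d] [e h] /=; ring.
rewrite -[_ * _ + _ * _]addrC -lin//; apply: eq_Rintegral => z _; rewrite /fock_integrand.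
by case: (f1 _) (f2 _) (g _) => [a b] [c d] [e h] /=; ring.
Qed.

End FockDot.

(** * Gram matrix of the coordinate functions *)

Section FockGram.
Variables (R : realType) (n : nat) (psi : R -> R).
Hypothesis hpsi : is_weight n psi.
Local Notation V := 'cV[R[i]]_n.
Local Notation dot := (fock_dot psi).
Implicit Types (f g : V -> R[i]) (A : 'M[R[i]]_n).

Lemma fock_dot_conj f g : in_fock psi f -> in_fock psi g -> dot f g = (dot g f)^*.
Proof.
move=> hf hg; rewrite !fock_dotE; have ii := integrable_Im hpsi hg hf.
have conjE (a b : R) : (a +i* b)^* = a +i* (- b) by [].
rewrite conjE; congr (_ +i* _).
  apply: eq_Rintegral => z _; rewrite /fock_integrand.
  by case: (f _) (g _) => [a b] [c d] /=; ring.
rewrite -mulN1r -RintegralZl//; apply: eq_Rintegral => z _; rewrite /fock_integrand.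
by case: (f _) (g _) => [a b] [c d] /=; ring.
Qed.

Lemma fock_dot0 g : in_fock psi g -> dot (fun=> 0) g = 0.
Proof.
move=> hg; have h0 := in_fock_cst hpsi 0.
have := fock_dot_lin hpsi 1 h0 h0 hg.
rewrite (_ : (fun _ : V => 1 * 0 + 0) = fun=> 0); last by apply/funext => z; rewrite mulr0 addr0.
by rewrite mul1r => /eqP; rewrite -subr_eq0 opprD addNKr oppr_eq0 => /eqP.
Qed.

Lemma fock_dot_scale a f g : in_fock psi f -> in_fock psi g ->
  dot (fun z => a * f z) g = a * dot f g.
Proof.
move=> hf hg; have := fock_dot_lin hpsi a hf (in_fock_cst hpsi 0) hg.
rewrite fock_dot0// addr0 => <-; congr dot.
by apply/funext => z; rewrite addr0.
Qed.

Lemma fock_dot_sum (I : Type) (s : seq I) (a : I -> R[i]) (f : I -> V -> R[i]) g :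
  (forall k, in_fock psi (f k)) -> in_fock psi g ->
  in_fock psi (fun z => \sum_(k <- s) a k * f k z) /\
  dot (fun z => \sum_(k <- s) a k * f k z) g = \sum_(k <- s) a k * dot (f k) g.
Proof.
move=> hf hg; elim: s => [|k s [hs IHs]].
  rewrite big_nil (_ : (fun z => _) = fun=> 0); last by apply/funext => z; rewrite big_nil.
  by rewrite fock_dot0//; split=> //; exact: in_fock_cst.
rewrite (_ : (fun z => _) = fun z => a k * f k z + \sum_(k <- s) a k * f k z); last first.
  by apply/funext => z; rewrite big_cons.
split; first exact: in_fock_lin.
by rewrite fock_dot_lin// IHs big_cons.
Qed.

Lemma fock_dot_unitary A f g : A ^t* *m A = 1%:M -> continuous f -> continuous g ->
  dot (fun z => f (A *m z)) (fun z => g (A *m z)) = dot f g.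
Proof.
move=> AA cf cg; have ci := continuous_integrand hpsi cf cg.
have E (P : R[i] -> R) : continuous P ->
    eintC (fun z => (P (fock_integrand psi (fun z => f (A *m z)) (fun z => g (A *m z)) z))%:E) =
    eintC (fun z => (P (fock_integrand psi f g z))%:E).
  move=> cP; rewrite -[RHS](eintC_unitary hpsi AA (comp_continuous ci cP)).
  congr eintC; apply/funext => z; rewrite /fock_integrand.
  by rewrite -(density_unitary psi z AA).
exact: (f_equal2 (fun a b => fine a +i* fine b) (E _ (@continuous_ReC R))
  (E _ (@continuous_ImC R))).
Qed.

Lemma fock_dot_eq0 g : in_fock psi g -> dot g g = 0 -> forall z, g z = 0.
Proof.
move=> [hg Ig] /(congr1 (@complex.Re R)) /= g0 z.
have cg := holomorphic_continuous hg.
have E : eintC (fun z => (complex.Re (g z * (g z)^* * (density psi z)%:C))%:E) =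
    eintC (EFin \o fock_mass psi g).
  congr eintC; apply/funext => y; congr EFin.
  rewrite Re_mul_real; congr (_ * _); rewrite cabs_sqr.
  by case: (g y) => a b /=; ring.
move: g0; rewrite E => g0.
have I0 : eintC (EFin \o fock_mass psi g) = 0%E.
  have I_ge0 : (0 <= eintC (EFin \o fock_mass psi g))%E.
    by apply: integral_ge0 => x _; rewrite lee_fin fock_mass_ge0.
  by rewrite -[LHS]fineK ?g0// ge0_fin_numE.
have := eintC_eq0 (continuous_fock_mass hpsi cg) (@fock_mass_ge0 _ _ psi g) I0 z.
move/eqP; rewrite mulf_eq0 (gt_eqF (density_gt0 psi z)) orbF sqrf_eq0 => /eqP c0.
by apply/eqP; rewrite -normr_eq0 cabsE c0.
Qed.

Let coord (j : 'I_n) : V -> R[i] := fun z => z j 0.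
Let hcoord j : in_fock psi (coord j) := in_fock_coord hpsi j.
Let ccoord j : continuous (coord j) := holomorphic_continuous (hcoord j).1.

(** Changing the sign of the j-th coordinate is unitary and turns the pairing into its opposite. *)
Lemma fock_coord_orth j k : j != k -> dot (coord j) (coord k) = 0.
Proof.
move=> jk; pose d : 'rV[R[i]]_n := \row_i (if i == j then - 1 else 1).
have dd : (diag_mx d) ^t* *m diag_mx d = 1%:M.
  apply/matrixP => a b; rewrite mul_mx_diag !mxE [b == a]eq_sym.
  case: (a == b); last by rewrite mulr0n rmorph0 mul0r.
  by rewrite mulr1n; case: ifP => _; rewrite ?rmorphN rmorph1 ?mulrNN mulr1.
have := fock_dot_unitary dd (@ccoord j) (@ccoord k).
rewrite (_ : (fun z => coord j _) = fun z => - 1 * coord j z); last first.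
  by apply/funext => z; rewrite /coord mul_diag_mx !mxE eqxx.
rewrite (_ : (fun z => coord k _) = coord k); last first.
  by apply/funext => z; rewrite /coord mul_diag_mx !mxE eq_sym (negbTE jk) mul1r.
rewrite fock_dot_scale// mulN1r => /eqP; rewrite eq_sym -subr_eq0 opprK -mulr2n.
by rewrite mulrn_eq0 => /eqP.
Qed.

(** The transposition of the two coordinates is unitary. *)
Lemma fock_coord_norm j k : dot (coord j) (coord j) = dot (coord k) (coord k).
Proof.
pose A : 'M[R[i]]_n := perm_mx (perm.tperm j k).
have AA : A ^t* *m A = 1%:M.
  by rewrite /A tr_perm_mx map_perm_mx perm.tpermV -perm_mxM perm.tperm2 perm_mx1.
rewrite -(fock_dot_unitary AA (@ccoord j) (@ccoord j)).
suff -> : (fun z => coord j (A *m z)) = coord k by [].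
by apply/funext => z; rewrite /coord /A -row_permE mxE perm.tpermL.
Qed.

Lemma fock_coord_neq0 j : dot (coord j) (coord j) != 0.
Proof.
apply/eqP => /(fock_dot_eq0 (hcoord j)) /(_ (delta_mx j 0)) /eqP.
by rewrite /coord mxE !eqxx oner_eq0.
Qed.

Lemma fock_dot_mulmx A j k : dot (fun z => (A *m z) j 0) (coord k) =
  A j k * dot (coord k) (coord k).
Proof.
have [_] := fock_dot_sum (index_enum 'I_n) (A j) hcoord (hcoord k).
rewrite (_ : (fun z => \sum_k _) = fun z => (A *m z) j 0); last first.
  by apply/funext => z; rewrite mxE.
move=> ->; rewrite (bigD1 k)//= big1 ?addr0// => m mk.
by rewrite fock_coord_orth ?mulr0.
Qed.

End FockGram.

(** * Weighted composition operators *)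

Section WeightedComposition.
Variables (R : realType) (n : nat) (psi : R -> R).
Hypothesis hpsi : is_weight n psi.
Local Notation V := 'cV[R[i]]_n.
Local Notation dot := (fock_dot psi).
Implicit Types (f g : V -> R[i]) (C : 'M[R[i]]_n).

Lemma opnorm0_le1 : opnorm (0 : 'M[R[i]]_n) <= 1.
Proof.
have norm0 : normC (0 : V) = 0.
  rewrite /normC /sqnormC /dotC big1 ?sqrtr0// => j _.
  by rewrite mxE mul0r.
apply: ge_sup; first by exists (normC ((0 : 'M[R[i]]_n) *m (0 : V))); exists 0; rewrite //= norm0.
by move=> _ [z _ <-]; rewrite mul0mx norm0 ler01.
Qed.

Lemma fock_dot_cst a g : in_fock psi g -> dot (fun=> a) g = dot (fun _ : V => a) (fun=> g 0).
Proof.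
move=> hg; have sa0 : selfadjoint_mx (0 : 'M[R[i]]_n).
  by rewrite /selfadjoint_mx trmx0 map_mx0.
rewrite [LHS](dot_swap hpsi sa0 opnorm0_le1 (in_fock_cst hpsi a) hg).
by congr dot; apply/funext => z; rewrite mul0mx.
Qed.

Lemma fock_dot_mulC (u : R[i]) f g : dot (fun z => u * f z) g = dot f (fun z => u^* * g z).
Proof. by congr intC; apply/funext => z; rewrite rmorphM /= conjCK mulrCA mulrA. Qed.

Lemma wcomp_selfadjoint_multiplier (C : 'M[R[i]]_n) U :
  in_fock psi U ->
  (forall f g, in_fock psi f -> in_fock psi g ->
     in_fock psi (fun z => U z * g (C *m z)) /\
     dot (fun z => U z * f (C *m z)) g = dot f (fun z => U z * g (C *m z))) ->
  forall z, U z = (U 0)^*.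
Proof.
move=> hU hT.
have h1 := in_fock_cst hpsi (1 : R[i]).
have E g : in_fock psi g -> dot U g = dot (fun=> (U 0)^*) g.
  move=> hg; have [hTg] := hT _ g h1 hg.
  rewrite (_ : (fun z => U z * 1) = U); last by apply/funext => z; rewrite mulr1.
  (* A pairing with a constant sees only the value at 0, and C 0 = 0: the transformed g enters
     through [U 0 * g 0] alone. *)
  move=> ->; rewrite [LHS]fock_dot_cst// mulmx0 [RHS]fock_dot_cst//.
  have := fock_dot_mulC (U 0)^* (fun _ : V => 1) (fun=> g 0).
  by rewrite conjCK mulr1 => ->.
have hc := in_fock_cst hpsi (U 0)^*.
(* The difference of U and the conjugate of U 0 is orthogonal to the whole space, itself
   included. *)
have hg := in_fock_lin hpsi (-1) hc hU.
have d0 :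
    dot (fun z => -1 * (U 0)^* + U z) (fun z => -1 * (U 0)^* + U z) = 0.
  by rewrite [LHS](fock_dot_lin hpsi (-1) hc hU hg) (E _ hg) [X in X + _]mulN1r addNr.
by move=> z; have /eqP := fock_dot_eq0 hpsi hg d0 z; rewrite mulN1r addrC subr_eq0 => /eqP.
Qed.

Lemma wcomp_selfadjoint_mx (C : 'M[R[i]]_n) (u : R[i]) : u != 0 -> u^* = u ->
  (forall f g, in_fock psi f -> in_fock psi g ->
     dot (fun z => u * f (C *m z)) g = dot f (fun z => u * g (C *m z))) ->
  selfadjoint_mx C.
Proof.
move=> u0 uu hT; apply/matrixP => j k; rewrite !mxE.
have hz := in_fock_coord hpsi.
have hCz i : in_fock psi (fun z : V => (C *m z) i 0).
  have [+ _] := fock_dot_sum hpsi (index_enum 'I_n) (C i) hz (hz i).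
  by congr in_fock; apply/funext => z; rewrite mxE.
have := hT _ _ (hz j) (hz k).
rewrite fock_dot_scale// fock_dot_mulmx//.
(* Conjugate symmetry brings C into the first slot, where its (k, j) entry can be read off. *)
rewrite [RHS](fock_dot_conj hpsi)//; last exact: in_fock_scale.
rewrite fock_dot_scale// fock_dot_mulmx// !rmorphM /= uu -(fock_dot_conj hpsi)//.
rewrite (fock_coord_norm hpsi j k) => /(mulfI u0) /mulIf -> //.
exact: fock_coord_neq0.
Qed.

Lemma wcomp_selfadjoint (C : 'M[R[i]]_n) (u : R[i]) f g : opnorm C <= 1 ->
  selfadjoint_mx C -> u^* = u -> in_fock psi f -> in_fock psi g ->
  dot (fun z => u * f (C *m z)) g = dot f (fun z => u * g (C *m z)).
Proof.
move=> C1 sa uu hf hg; have hg' := in_fock_scale hpsi u hg.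
rewrite -(dot_swap hpsi sa C1 hf hg') [RHS](_ : _ = dot (fun z => f (C *m z)) (fun z => u^* * g z)).
  by rewrite -fock_dot_mulC.
by rewrite uu.
Qed.

End WeightedComposition.

Theorem proposition2p7 (R : realType) (n : nat) (hn : (0 < n)%N)
    (psi : R -> R) (hpsi : is_weight n psi)
    (C : 'M[R[i]]_n) (hC : opnorm C <= 1)
    (U : 'cV[R[i]]_n -> R[i]) (hU : holomorphic U)
    (hbounded : bounded_on_fock psi (wcomp U (fun z => C *m z))) :
  (selfadjoint_on_fock psi (wcomp U (fun z => C *m z)) <->
     (forall z, U z = (U 0)^*) /\
     exactly_one (U 0 = 0) (U 0 <> 0 /\ selfadjoint_mx C))
  /\
  ((forall z, U z = (U 0)^*) -> U 0 = 0 ->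
     (forall z, U z = 0) /\
     (forall f, in_fock psi f -> wcomp U (fun z => C *m z) f = (fun=> 0))).
Proof.
(* At z = 0 the hypothesis says that U 0 is its own conjugate. *)
have real_cst : (forall z, U z = (U 0)^*) -> exists2 u, u^* = u & U = fun=> u.
  by move=> Uc; exists (U 0); [rewrite -(Uc 0)|apply/funext => z; rewrite Uc -(Uc 0)].
have [bT _ _] := hbounded; split; [split|].
- move=> [_ adj].
  (* U is the image of the constant 1. *)
  have hU1 : in_fock psi U.
    have := bT _ (in_fock_cst hpsi 1); congr in_fock.
    by apply/funext => z; rewrite /wcomp mulr1.
  have Uc := wcomp_selfadjoint_multiplier hpsi hU1
    (fun f g hf hg => conj (bT g hg) (adj f g hf hg)).
  split=> //; split; last by case=> U0 [].
  have [|U0] := eqVneq (U 0) 0; [by left|right; split; first exact/eqP].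
  have [u uu Uu] := real_cst Uc; rewrite Uu in U0 adj.
  exact: (wcomp_selfadjoint_mx hpsi U0 uu adj).
- move=> [/real_cst[u uu Uu] [U0C _]]; split=> // f g hf hg.
  move: U0C; rewrite /wcomp Uu => -[->|[_ sa]]; last exact: wcomp_selfadjoint.
  by congr intC; apply/funext => z; rewrite !mul0r rmorph0 mulr0 mul0r.
- move=> Uc U0; have Uz z : U z = 0 by rewrite Uc U0 conjC0.
  by split=> // f _; apply/funext => z; rewrite /wcomp Uz mul0r.
Qed.
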